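(* Let $\mathcal{P}$ be a graded poset for which there exist an adequate local covering family and a global covering family $\mathcal{K}$. Let $b_n$ be the $n$-th Betti number of $\mathcal{P}$, i.e. the rank of $H^n(\mathcal{P};\mathbb{Z})$. Then $$b_n\le b^{\mathcal{K}}_n$$ and $$b_n-b_{n-1}+\cdots+(-1)^n b_0\le b^{\mathcal{K}}_n-b^{\mathcal{K}}_{n-1}+\cdots+(-1)^n b^{\mathcal{K}}_0$$ for any $n\ge0$.
   Context: Posets. A poset is regarded as a category $\mathcal{P}$ with exactly one arrow $p\to p'$ if $p\le p'$ and none otherwise. For $p<p'$, $p$ precedes $p'$ if $p\le p''\le p'$ implies $p''=p$ or $p''=p'$. $\mathcal{P}$ is graded if it is equipped with a degree function $\deg:\mathrm{Ob}(\mathcal{P})\to\mathbb{Z}$ which is order reversing and satisfies $\deg(p)=\deg(p')+1$ whenever $p$ precedes $p'$. Standing assumptions on every graded poset: $\{p\mid p_0\le p\}$ is finite for every $p_0$, and $\deg$ takes values in $\{0,1,2,\ldots\}$. $\mathrm{Ob}_n(\mathcal{P})$ is the set of objects of degree $n$. $(p_0\downarrow\mathcal{P})$, $(p_0\downarrow\mathcal{P})_*$, $(p_0\downarrow\mathcal{P})_n$ are the full subcategories (also used for their sets of objects) on $\{p\mid p_0\le p\}$, $\{p\mid p_0<p\}$, $\{p\mid p_0\le p,\ \deg p=n\}$. $c_{\mathbb{Z}}$ is the constant functor with value $\mathbb{Z}$, and $H^*(\mathcal{P};\mathbb{Z})=\varprojlim^* c_{\mathbb{Z}}$, which equals the integral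 cohomology of the realization $|\mathcal{P}|$. Local covering families. A family $\mathcal{J}=\{J^{p_0}_n\}_{p_0\in\mathrm{Ob}(\mathcal{P}),\,0\le n\le\deg(p_0)}$ with $J^{p_0}_n\subseteq(p_0\downarrow\mathcal{P})_n$ is a local covering family if (a) for each $p_0$ and $0\le n<\deg(p_0)$, $\bigcup_{p\in J^{p_0}_{n+1}}(p\downarrow\mathcal{P})_n=(p_0\downarrow\mathcal{P})_n$; (b) for each $p_0$, $0\le n<\deg(p_0)$ and $p\in J^{p_0}_{n+1}$, $J^p_n\subseteq J^{p_0}_n$. Define numbers $R^{p_0}_n$ for $\deg(p_0)\ge n$ by $R^{p_0}_0=1$ and $R^{p_0}_n=\sum_{p\in(p_0\downarrow\mathcal{P})_{n-1}}R^p_{n-1}-R^{p_0}_{n-1}$ for $n\ge1$. $\mathcal{J}$ is adequate if $(p_0\downarrow\mathcal{P})_*$ is connected whenever $\deg(p_0)\ge2$, and $R^{p_0}_n=\sum_{p\in J^{p_0}_n}R^p_n$ for all $n\ge0$ and $\deg(p_0)\ge n+1$. The functors $F_n$. $F_0=c_{\mathbb{Z}}$, and for $n\ge1$, $F_n(p_0)$ is the cokernel of the map $F_{n-1}(p_0)\to\prod_{p\in(p_0\downarrow\mathcal{P})_{n-1}}F_{n-1}(p)$ with components $F_{n-1}(p_0\to p)$; arrows act by the maps induced by the projections between the products. Define $d_n:\prod_{p\in\mathrm{Ob}_n(\mathcal{P})}F_n(p)\to\prod_{q\in\mathrm{Ob}_{n+1}(\mathcal{P})}F_{n+1}(q)$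 by letting $d_n(x)_q$ be the class of $(x_p)_{p\in(q\downarrow\mathcal{P})_n}$ in $F_{n+1}(q)$. Global covering families. A map between free abelian groups is pure if its cokernel is a free abelian group. A global covering family is a family $\mathcal{K}=\{K_n\}_{n\ge0}$ with $K_n\subseteq\mathrm{Ob}_n(\mathcal{P})$ such that (1) the restriction map $\varprojlim F_n\to\prod_{p\in K_n}F_n(p)$ is injective for each $n\ge0$; (2) for each $n\ge1$ the map $\prod_{p\in\mathrm{Ob}_{n-1}(\mathcal{P})\setminus K_{n-1}}F_{n-1}(p)\to\prod_{p\in K_n}F_n(p)$, obtained from $d_{n-1}$ by precomposing with the inclusion (extension by zero) and postcomposing with the projection, is pure. The Betti numbers of $\mathcal{K}$ are $b^{\mathcal{K}}_0=\sum_{p\in K_0}R^p_0$ and $b^{\mathcal{K}}_n=\sum_{p\in K_{n-1}}R^p_{n-1}-\sum_{p\in\mathrm{Ob}_{n-1}(\mathcal{P})}R^p_{n-1}+\sum_{p\in K_n}R^p_n$ for $n\ge1$. *)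

(* Defs.v *)
From HB Require Import structures.
From mathcomp Require Import all_boot all_order all_algebra.
From mathcomp Require Import boolp classical_sets functions cardinality fsbigop.
Set Implicit Arguments.
Unset Strict Implicit.
Unset Printing Implicit Defensive.
Import Order.TTheory GRing.Theory Num.Theory.
Local Open Scope classical_set_scope.
Local Open Scope ring_scope.

Section DependentProduct.
Variables (I : Type) (M : I -> zmodType).

Definition dprod := forall i : I, M i.

HB.instance Definition _ := gen_eqMixin dprod.
HB.instance Definition _ := gen_choiceMixin dprod.

Let dadd (x y : dprod) : dprod := fun i => x i + y i.
Let dopp (x : dprod) : dprod := fun i => - x i.
Let dzero : dprod := fun i => 0.

Let daddA : associative dadd.
Proof. by move=> x y z; apply: functional_extensionality_dep => i; exact: addrA. Qed.
Let daddC : commutative dadd.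
Proof. by move=> x y; apply: functional_extensionality_dep => i; exact: addrC. Qed.
Let dadd0 : left_id dzero dadd.
Proof. by move=> x; apply: functional_extensionality_dep => i; exact: add0r. Qed.
Let daddN : left_inverse dzero dopp dadd.
Proof. by move=> x; apply: functional_extensionality_dep => i; exact: addNr. Qed.

HB.instance Definition _ := GRing.isZmodule.Build dprod daddA daddC dadd0 daddN.

End DependentProduct.

Definition subzmod (V : zmodType) (S : zmodClosed V) := {x : V | x \in S}.

HB.instance Definition _ V S := SubChoice.on (@subzmod V S).
HB.instance Definition _ V S := [SubChoice_isSubZmodule of @subzmod V S by <:].

Section KernelCokernel.
Variables (A B : zmodType) (f : {additive A -> B}).

Definition kerp : {pred A} := fun x => f x == 0.
Lemma kerp_closed : zmod_closed kerp.
Proof.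
split=> [|x y]; rewrite !unfold_in /kerp ?raddf0 // raddfB => /eqP-> /eqP->.
by rewrite subr0.
Qed.
HB.instance Definition _ := GRing.isZmodClosed.Build A kerp kerp_closed.

Definition imp : {pred B} := fun y => `[< exists x, f x = y >].
Lemma imp_closed : zmod_closed imp.
Proof.
split=> [|x y]; rewrite !unfold_in /imp; first by apply/asboolP; exists 0; rewrite raddf0.
move=> /asboolP[a <-] /asboolP[b <-].
by apply/asboolP; exists (a - b); rewrite raddfB.
Qed.
HB.instance Definition _ := GRing.isZmodClosed.Build B imp imp_closed.

Definition kernel : zmodType := subzmod kerp.
Definition cokernel : zmodType := Quotient.quot imp.
Definition coker_pi : B -> cokernel := \pi_cokernel%qT.

Lemma coker_pi_zmod : zmod_morphism coker_pi.
Proof. exact: (raddfB (\pi_(Quotient.quot imp)%qT)). Qed.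
HB.instance Definition _ := GRing.isZmodMorphism.Build B cokernel coker_pi coker_pi_zmod.

End KernelCokernel.

Section CokernelProjection.
Variables (A B : zmodType) (f : {additive A -> B}).

Lemma coker_piP (x y : B) : coker_pi f x = coker_pi f y <-> exists a, f a = x - y.
Proof.
split=> [/eqP|[a fa]].
  by rewrite /coker_pi -Quotient.idealrBE => /asboolP.
by apply/eqP; rewrite /coker_pi -Quotient.idealrBE; apply/asboolP; exists a.
Qed.

Lemma coker_pi_repr (c : cokernel f) : coker_pi f (repr c) = c.
Proof. by rewrite /coker_pi reprK. Qed.

End CokernelProjection.

Arguments coker_piP {A B} f x y.

Section CokernelMap.
Variables (A B A' B' : zmodType).
Variables (f : {additive A -> B}) (f' : {additive A' -> B'}).
Variable g : {additive B -> B'}.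
Hypothesis gim : forall a, exists a', f' a' = g (f a).

Definition coker_map (c : cokernel f) : cokernel f' := coker_pi f' (g (repr c)).

Lemma coker_mapE (b : B) : coker_map (coker_pi f b) = coker_pi f' (g b).
Proof.
apply/coker_piP; have [a fa] := (coker_piP f _ _).1 (coker_pi_repr (coker_pi f b)).
by have [a' fa'] := gim a; exists a'; rewrite fa' fa raddfB.
Qed.

Lemma coker_map_zmod : zmod_morphism coker_map.
Proof.
move=> x y; rewrite -(coker_pi_repr x) -(coker_pi_repr y) -raddfB !coker_mapE.
by rewrite -!raddfB.
Qed.

Definition coker_hom : {additive cokernel f -> cokernel f'} :=
  HB.pack coker_map (GRing.isZmodMorphism.Build _ _ coker_map coker_map_zmod).

End CokernelMap.

Definition zindep (M : zmodType) (B : set M) : Prop :=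
  forall (s : seq M) (c : M -> int), uniq s -> [set` s] `<=` B ->
    \sum_(x <- s) x *~ c x = 0 -> forall x, x \in s -> c x = 0.

(* The rank as the maximal number of Z-linearly independent elements; a group of
   infinite rank satisfies [has_rank] for no r. *)
Definition has_rank (M : zmodType) (r : nat) : Prop :=
  (exists s : seq M, [/\ uniq s, size s = r & zindep [set` s]]) /\
  (forall s : seq M, uniq s -> zindep [set` s] -> (size s <= r)%N).

Definition free_abelian (M : zmodType) : Prop :=
  exists B : set M, zindep B /\
    forall x : M, exists (s : seq M) (c : M -> int),
      [set` s] `<=` B /\ x = \sum_(b <- s) b *~ c b.

Definition pure (A B : zmodType) (f : {additive A -> B}) : Prop :=
  [/\ free_abelian A, free_abelian B & free_abelian (cokernel f)].

Section Functors.
Variables (disp : Order.disp_t) (P : porderType disp).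

Record pfunctor := PFunctor {
  fobj :> P -> zmodType;
  fmap : forall p q : P, (p <= q)%O -> {additive fobj p -> fobj q};
  fmap_id : forall (p : P) (h : (p <= p)%O) (x : fobj p), fmap h x = x;
  fmap_comp : forall (p q r : P) (hpq : (p <= q)%O) (hqr : (q <= r)%O)
    (hpr : (p <= r)%O) (x : fobj p), fmap hqr (fmap hpq x) = fmap hpr x
}.

Record nat_trans (F G : pfunctor) := NatTrans {
  nt_app :> forall p : P, {additive F p -> G p};
  nt_nat : forall (p q : P) (h : (p <= q)%O) (x : F p),
    nt_app q (fmap F h x) = fmap G h (nt_app p x)
}.

Definition const_functor (M : zmodType) : pfunctor :=
  @PFunctor (fun=> M) (fun _ _ _ => idfun) (fun _ _ _ => erefl)
    (fun _ _ _ _ _ _ _ => erefl).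

Section Limit.
Variable F : pfunctor.

Definition limp : {pred dprod F} :=
  fun x => `[< forall (p q : P) (h : (p <= q)%O), fmap F h (x p) = x q >].
Lemma limp_closed : zmod_closed limp.
Proof.
split=> [|x y]; rewrite !unfold_in /limp.
  by apply/asboolP => p q h; exact: raddf0.
move=> /asboolP hx /asboolP hy; apply/asboolP => p q h.
by rewrite raddfB hx hy.
Qed.
HB.instance Definition _ := GRing.isZmodClosed.Build (dprod F) limp limp_closed.

Definition limF : zmodType := subzmod limp.

End Limit.

Arguments limp F : clear implicits.

Section LimitMap.
Variables (F G : pfunctor) (t : nat_trans F G).

Lemma lim_map_subproof (x : limF F) : (fun p => t p (val x p)) \in limp G.
Proof.
apply/asboolP => p q h; rewrite -nt_nat; congr (t q _).
by have /asboolP := valP x; apply.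
Qed.

Definition lim_fun (x : limF F) : limF G :=
  exist (fun y : dprod G => y \in limp G) _ (lim_map_subproof x).

Lemma lim_fun_zmod : zmod_morphism lim_fun.
Proof.
move=> x y; apply: val_inj; apply: functional_extensionality_dep => p /=.
exact: raddfB.
Qed.

Definition lim_map : {additive limF F -> limF G} :=
  HB.pack lim_fun (GRing.isZmodMorphism.Build _ _ lim_fun lim_fun_zmod).

End LimitMap.

Definition injective_functor (I : pfunctor) : Prop :=
  forall (G H : pfunctor) (u : nat_trans G H) (v : nat_trans G I),
    (forall p, injective (u p)) ->
    exists w : nat_trans H I, forall p x, w p (u p x) = v p x.

(* 0 -> G -> I^0 -> I^1 -> ... exact, i.e. exact at each object of P *)
Record injective_resolution (G : pfunctor) := InjectiveResolution {
  ir_obj : nat -> pfunctor;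
  ir_aug : nat_trans G (ir_obj 0);
  ir_d : forall n, nat_trans (ir_obj n) (ir_obj n.+1);
  ir_injective : forall n, injective_functor (ir_obj n);
  ir_aug_inj : forall p, injective (ir_aug p);
  ir_exact0 : forall p (x : ir_obj 0 p),
    ir_d 0 p x = 0 <-> exists y, ir_aug p y = x;
  ir_exactS : forall n p (x : ir_obj n.+1 p),
    ir_d n.+1 p x = 0 <-> exists y, ir_d n p y = x
}.

(* (ker g) / (im f); when g \o f = 0 fails, im f is replaced by im f `&` ker g. *)
Section Cohomology.
Variables (A B C : zmodType) (f : {additive A -> B}) (g : {additive B -> C}).

Definition boundp : {pred kernel g} := fun z => val z \in imp f.
Lemma boundp_closed : zmod_closed boundp.
Proof.
split=> [|x y]; first exact: (rpred0 (imp f)).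
exact: (@rpredB _ (imp f) (val x) (val y)).
Qed.
HB.instance Definition _ := GRing.isZmodClosed.Build (kernel g) boundp boundp_closed.

Definition cohom : zmodType := Quotient.quot boundp.

End Cohomology.

(* The n-th right derived functor of the inverse limit at [G], computed from
   an injective resolution: H^n of lim I^0 -> lim I^1 -> ... *)
Definition higher_lim (G : pfunctor) (I : injective_resolution G) (n : nat) :
    zmodType :=
  match n with
  | 0 => kernel (lim_map (ir_d I 0))
  | m.+1 => cohom (lim_map (ir_d I m)) (lim_map (ir_d I m.+1))
  end.

Definition prodF (F : pfunctor) (A : set P) : zmodType :=
  dprod (fun p : A => F (val p)).

Definition to_prodF (F : pfunctor) (A : set P) (x : forall p : A, F (val p)) :
  prodF F A := x.

Definition set_incl (A B : set P) (h : A `<=` B) (p : A) : B :=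
  exist _ (val p) (mem_set (h _ (set_mem (valP p)))).

Section ProductMaps.
Variables (F : pfunctor) (A B : set P) (h : A `<=` B).

Definition prod_proj_fun (x : prodF F B) : prodF F A :=
  to_prodF (fun p : A => x (set_incl h p)).
Lemma prod_proj_zmod : zmod_morphism prod_proj_fun.
Proof. by []. Qed.
Definition prod_proj : {additive prodF F B -> prodF F A} :=
  HB.pack prod_proj_fun
    (GRing.isZmodMorphism.Build _ _ prod_proj_fun prod_proj_zmod).

(* extension by zero; the values at points outside [B] are dropped *)
Definition prod_ext_fun (x : prodF F A) : prodF F B :=
  to_prodF (fun p : B =>
    match pselect (A (val p)) with
    | left hp => x (exist _ (val p) (mem_set hp))
    | right _ => 0
    end).
Lemma prod_ext_zmod : zmod_morphism prod_ext_fun.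
Proof.
move=> x y; apply: functional_extensionality_dep => p.
change (prod_ext_fun (x - y) p = prod_ext_fun x p - prod_ext_fun y p).
rewrite /prod_ext_fun /to_prodF.
by case: (pselect (A (val p))) => [//|_]; rewrite subr0.
Qed.
Definition prod_ext : {additive prodF F A -> prodF F B} :=
  HB.pack prod_ext_fun
    (GRing.isZmodMorphism.Build _ _ prod_ext_fun prod_ext_zmod).

End ProductMaps.

Variable deg : P -> nat.

Definition precedes (p q : P) : Prop :=
  (p < q)%O /\ forall r : P, (p <= r)%O -> (r <= q)%O -> r = p \/ r = q.

(* The standing assumptions are included: degrees are natural numbers and
   every set of the form {p | p0 <= p} is finite. *)
Record graded : Prop := Graded {
  graded_rev : forall p q : P, (p <= q)%O -> (deg q <= deg p)%N;
  graded_cover : forall p q : P, precedes p q -> deg p = (deg q).+1;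
  graded_finite : forall p0 : P, finite_set [set p : P | (p0 <= p)%O]
}.

Definition Ob (n : nat) : set P := [set p | deg p = n].
Definition up (p0 : P) (n : nat) : set P := [set p | (p0 <= p)%O /\ deg p = n].
Definition strict_up (p0 : P) : set P := [set p | (p0 < p)%O].

(* Connectedness of a full subcategory: nonempty, and any two objects are joined
   by a zigzag of arrows. *)
Definition connected (A : set P) : Prop :=
  A !=set0 /\ forall x y, A x -> A y ->
    exists s : seq P, [/\ [set` s] `<=` A,
      path (fun a b => (a >=< b)%O) x s & last x s = y].

(* Only meaningful when n <= deg p0. *)
Fixpoint Rnum (n : nat) (p0 : P) : int :=
  match n with
  | 0 => 1
  | m.+1 => (\sum_(p \in up p0 m) Rnum m p) - Rnum m p0
  end.

Definition local_covering_family (J : P -> nat -> set P) : Prop :=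
  [/\ forall p0 n, (n <= deg p0)%N -> J p0 n `<=` up p0 n,
      forall p0 n, (n < deg p0)%N ->
        \bigcup_(p in J p0 n.+1) up p n = up p0 n
    & forall p0 n p, (n < deg p0)%N -> J p0 n.+1 p -> J p n `<=` J p0 n].

Definition adequate (J : P -> nat -> set P) : Prop :=
  (forall p0, (2 <= deg p0)%N -> connected (strict_up p0)) /\
  (forall n p0, (n < deg p0)%N -> Rnum n p0 = \sum_(p \in J p0 n) Rnum n p).

Section NextFunctor.
Variables (n : nat) (F : pfunctor).

Definition unit_fun (p0 : P) (x : F p0) : prodF F (up p0 n) :=
  to_prodF (fun p : up p0 n => fmap F (set_mem (valP p)).1 x).
Lemma unit_zmod p0 : zmod_morphism (@unit_fun p0).
Proof. by move=> x y; apply: functional_extensionality_dep => p; exact: raddfB. Qed.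
Definition unit_hom (p0 : P) : {additive F p0 -> prodF F (up p0 n)} :=
  HB.pack (@unit_fun p0)
    (GRing.isZmodMorphism.Build _ _ (@unit_fun p0) (@unit_zmod p0)).

Lemma up_sub (p q : P) : (p <= q)%O -> up q n `<=` up p n.
Proof. by move=> pq r [qr dr]; split=> //; exact: le_trans qr. Qed.

Lemma unit_compat (p q : P) (h : (p <= q)%O) (x : F p) :
  exists y, unit_hom q y = prod_proj F (up_sub h) (unit_hom p x).
Proof.
exists (fmap F h x); apply: functional_extensionality_dep => r.
exact: fmap_comp.
Qed.

Definition next_obj (p : P) : zmodType := cokernel (unit_hom p).
Definition next_map (p q : P) (h : (p <= q)%O) :
  {additive next_obj p -> next_obj q} := coker_hom (unit_compat h).

Lemma next_id (p : P) (h : (p <= p)%O) (x : next_obj p) : next_map h x = x.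
Proof.
rewrite -{2}(coker_pi_repr x); congr coker_pi.
apply: functional_extensionality_dep => -[r hr].
by rewrite /= /prod_proj_fun /to_prodF /set_incl /= (bool_irrelevance (mem_set _) hr).
Qed.

Lemma next_comp (p q r : P) (hpq : (p <= q)%O) (hqr : (q <= r)%O)
    (hpr : (p <= r)%O) (x : next_obj p) :
  next_map hqr (next_map hpq x) = next_map hpr x.
Proof.
rewrite [next_map hpq x]/= /coker_map [LHS](coker_mapE (unit_compat hqr)).
congr coker_pi; apply: functional_extensionality_dep => -[s hs].
rewrite /= /prod_proj_fun /to_prodF /set_incl /=.
by congr (repr x (exist _ s _)); exact: bool_irrelevance.
Qed.

Definition next_functor : pfunctor := PFunctor next_id next_comp.

End NextFunctor.

Fixpoint Fn (n : nat) : pfunctor :=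
  match n with
  | 0 => const_functor int
  | m.+1 => next_functor m (Fn m)
  end.

Lemma up_Ob (n : nat) (q : P) : up q n `<=` Ob n.
Proof. by move=> p []. Qed.

Definition dn_fun (n : nat) (x : prodF (Fn n) (Ob n)) :
    prodF (Fn n.+1) (Ob n.+1) :=
  to_prodF (F := Fn n.+1) (fun q : Ob n.+1 =>
    coker_pi (unit_hom n (Fn n) (val q)) (prod_proj (Fn n) (@up_Ob n (val q)) x)).
Lemma dn_zmod n : zmod_morphism (@dn_fun n).
Proof.
move=> x y; apply: functional_extensionality_dep => q.
by rewrite /dn_fun /to_prodF !raddfB.
Qed.
Definition dn (n : nat) :
    {additive prodF (Fn n) (Ob n) -> prodF (Fn n.+1) (Ob n.+1)} :=
  HB.pack (@dn_fun n) (GRing.isZmodMorphism.Build _ _ (@dn_fun n) (@dn_zmod n)).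

Definition lim_restr (F : pfunctor) (A : set P) (x : limF F) : prodF F A :=
  to_prodF (fun p : A => val x (val p)).

Record global_covering_family (K : nat -> set P) : Prop := GlobalCoveringFamily {
  gcf_sub : forall n, K n `<=` Ob n;
  gcf_inj : forall n, injective (@lim_restr (Fn n) (K n));
  gcf_pure : forall n,
    pure (prod_proj (Fn n.+1) (@gcf_sub n.+1) \o dn n
          \o prod_ext (Fn n) (Ob n `\` K n) (Ob n))
}.

Definition covering_betti (K : nat -> set P) (n : nat) : int :=
  match n with
  | 0 => \sum_(p \in K 0%N) Rnum 0 p
  | m.+1 => (\sum_(p \in K m) Rnum m p) - (\sum_(p \in Ob m) Rnum m p)
            + (\sum_(p \in K m.+1) Rnum m.+1 p)
  end.

(* [\sum_(p \in A)] is 0 by convention when the support is infinite, so the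
   numbers above are meaningful only under the following condition: the sums
   defining [covering_betti K i], i <= n, have finitely many nonzero terms.
   (When [K i] is contained in [Ob i], the sums over [K i], i < n, are finite
   as soon as those over [Ob i] are.) *)
Definition covering_betti_defined (K : nat -> set P) (n : nat) : Prop :=
  (forall m, (m < n)%N -> finite_set [set p | Ob m p /\ Rnum m p <> 0]) /\
  finite_set [set p | K n p /\ Rnum n p <> 0].

End Functors.

(* Main.v *)
(** Write l_n for the rank of lim F_n, and k_n, c_n for the sums of R_n over K_n
    and Ob_n. The embedding of lim F_n into the product over K_n gives
    l_n <= k_n. Since b_n = l_n + l_(n-1) - c_(n-1) and
    b^K_n = k_n + k_(n-1) - c_(n-1), the first inequality follows, and so does
    the second, because the two alternating sums differ by l_n - k_n.

    The formula for b_n comes from the short exact sequences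
    0 -> F_n -> G_n -> F_(n+1) -> 0, where G_n(p) is the product of F_n over the
    elements of degree n above p: they splice to a resolution of the constant
    functor by the G_n, which are acyclic for lim, and lim G_n is the product of
    F_n over Ob_n. Acyclicity is used in the form that sections over {q > p}
    extend to p, which injective functors also satisfy; so the mapping cone of a
    comparison map from the G_n to any injective resolution is an exact complex
    of such functors, and stays exact after applying lim.

    That F_n(p) is torsion-free of rank R_n(p), and F_n -> G_n is injective, is
    shown by induction on n together with the fact that F_n(p) restricts
    isomorphically to the product of F_n over J^p_n when deg p > n. *)

Require Import Defs.
From HB Require Import structures.
From mathcomp Require Import all_boot all_order all_algebra ring.
From mathcomp Require Import finmap boolp classical_sets functions cardinality fsbigop.
Set Implicit Arguments.
Unset Strict Implicit.
Unset Printing Implicit Defensive.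
Import Order.TTheory GRing.Theory Num.Theory.
Local Open Scope ring_scope.

(** * Rank of abelian groups *)

Section Rank.
Variable M : zmodType.

Definition indep r (v : 'I_r -> M) :=
  forall c : 'I_r -> int, \sum_i v i *~ c i = 0 -> forall i, c i = 0.

(** Says that [v] spans the tensor product of [M] with the rationals, without forming that product;
    [qrank] is then its dimension. *)
Definition qspan r (v : 'I_r -> M) :=
  forall x, exists2 k : int, k != 0 & exists c : 'I_r -> int,
    x *~ k = \sum_i v i *~ c i.

Definition qrank r := exists v : 'I_r -> M, indep v /\ qspan v.

End Rank.

(** Over the rationals a matrix with more rows than columns has a nonzero row vector in its left
    kernel; clearing denominators makes it integral. *)
Lemma int_row_kernel m r (C : 'M[int]_(m, r)) : (r < m)%N ->
  exists2 u : 'I_m -> int, exists j, u j != 0 &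
    forall i, \sum_j u j * C j i = 0.
Proof.
move=> ltrm; pose Q : 'M[rat]_(m, r) := map_mx intr C.
have /rowV0Pn[u uK u0] : kermx Q != 0.
  rewrite -mxrank_eq0 mxrank_ker subn_eq0 -ltnNge.
  exact: leq_ltn_trans (rank_leq_col _) ltrm.
have uQ : u *m Q = 0 by apply/sub_kermxP.
pose d : int := \prod_j denq (u 0 j).
(* [d] is the product of all denominators, and [w] is [u] multiplied by [d]. *)
have dn0 : d != 0 by apply/prodf_neq0 => j _; exact: denq_neq0.
pose w j : int := numq (u 0 j) * \prod_(i | i != j) denq (u 0 i).
have wE j : (w j)%:~R = u 0 j * d%:~R :> rat.
  rewrite /w /d [in RHS](bigD1 j) //= !intrM mulrA; congr (_ * _).
  exact: numqE.
exists w => [|i].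
  have [j uj] : exists j, u 0 j != 0.
    apply/existsP; apply: contraNT u0 => /existsPn h.
    by apply/eqP/rowP => j; rewrite mxE; apply/eqP; move/negPn: (h j).
  by exists j; rewrite -(intr_eq0 rat) wE mulf_neq0 ?intr_eq0.
apply: (@intr_inj rat); rewrite rmorph_sum /=.
transitivity ((u *m Q) 0 i * d%:~R); last by rewrite uQ mxE mul0r.
rewrite mxE mulr_suml; apply: eq_bigr => j _.
by rewrite intrM wE !mxE mulrAC.
Qed.

Section RankTheory.
Implicit Types M A B C : zmodType.

(** Multiples of the [w j] are combinations of the [v i]. If there were more [w] than [v], a
    relation between the rows of coefficients would yield a relation between the [w j]. *)
Lemma indep_leq M r m (v : 'I_r -> M) (w : 'I_m -> M) :
  qspan v -> indep w -> (m <= r)%N.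
Proof.
move=> vs wi; rewrite leqNgt; apply/negP => ltrm.
have /choice[k hk] j : exists k : int, k != 0 /\ exists c : 'I_r -> int,
    w j *~ k = \sum_i v i *~ c i by have [k] := vs (w j); exists k.
have /choice[c hc] j : exists c : 'I_r -> int, w j *~ k j = \sum_i v i *~ c i.
  by have [] := hk j.
have [u [j uj] uC] := int_row_kernel (\matrix_(j, i) c j i) ltrm.
suff /(_ j)/eqP : forall l, k l * u l = 0.
  by rewrite mulf_eq0 (negPf uj) (negPf (proj1 (hk j))).
apply: wi.
under eq_bigr => l _ do rewrite mulrzA hc mulrz_suml.
rewrite exchange_big big1 //= => i _.
under eq_bigr => l _ do rewrite -mulrzA mulrC.
rewrite -mulrz_sumr -[RHS](mulr0z (v i)) -[0 in RHS](uC i).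
by congr (_ *~ _); apply: eq_bigr => l _; rewrite mxE.
Qed.

Lemma qrank_unique M r m : qrank M r -> qrank M m -> r = m.
Proof.
move=> [v [vi vs]] [w [wi ws]]; apply/eqP.
by rewrite eqn_leq (indep_leq ws vi) (indep_leq vs wi).
Qed.

(** Adjoining [x] to a longest independent family creates a relation; its coefficient at [x] is
    nonzero because [w] itself is independent. *)
Lemma indep_max M r (w : 'I_r -> M) : indep w ->
  (forall m (w' : 'I_m -> M), indep w' -> (m <= r)%N) -> qspan w.
Proof.
move=> wi rmax x.
pose w' (i : 'I_r.+1) := if unlift ord0 i is Some j then w j else x.
apply: contrapT => hx; suff /rmax : indep w' by rewrite ltnn.
move=> c; rewrite big_ord_recl {1}/w' unlift_none.
under eq_bigr => j _ do rewrite /w' liftK.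
have [c0|c0] := eqVneq (c ord0) 0.
  rewrite c0 mulr0z add0r => /wi h i.
  by case: (unliftP ord0 i) => [j|] ->; [exact: h | exact: c0].
move=> h; case: hx; exists (c ord0) => //; exists (fun j => - c (lift ord0 j)).
under eq_bigr => j _ do rewrite mulrNz.
by rewrite sumrN; apply/eqP; rewrite -addr_eq0; apply/eqP.
Qed.

Lemma qrank_bounded M N :
  (forall m (w : 'I_m -> M), indep w -> (m <= N)%N) ->
  exists2 r, (r <= N)%N & qrank M r.
Proof.
move=> hN; pose E m := `[< exists w : 'I_m -> M, indep w >].
have E0 : exists m, E m by exists 0%N; apply/asboolP; exists (fun=> 0) => c _ [].
have EN m : E m -> (m <= N)%N by move=> /asboolP[w /hN].
case: (ex_maxnP E0 EN) => r Er rmax.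
exists r; first exact: EN.
have /asboolP[w wi] := Er; exists w; split=> //; apply: indep_max => // m w' w'i.
by apply: rmax; apply/asboolP; exists w'.
Qed.

Lemma has_rank_qrank M r : qrank M r -> has_rank M r.
Proof.
move=> [v [vi vs]]; split.
  have vI : injective v.
    move=> i j vij; apply/eqP/negPn/negP => nij.
    (* A repeated value would satisfy the relation with coefficient 1 at [i] and -1 at [j]. *)
    suff /(_ i)/eqP : forall l, (l == i)%:Z - (l == j)%:Z = 0.
      by rewrite eqxx (negPf nij) subr0 oner_eq0.
    apply: vi.
    under eq_bigr => l _ do rewrite mulrzBr.
    rewrite sumrB [X in X - _](bigD1 i) //= [X in _ - X](bigD1 j) //= !eqxx.
    rewrite !big1 ?addr0 ?vij ?subrr // => l /negPf->; exact: mulr0z.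
  exists (codom v); split; [exact/injectiveP|by rewrite size_codom card_ord|].
  move=> t c tu ts tc x xt.
  have /codomP[i xi] : x \in codom v by exact: ts.
  (* A relation over part of the family becomes one over all indices by putting zero coefficients
     outside [t]. *)
  suff /(_ i) : forall j, (if v j \in t then c (v j) else 0) = 0 by rewrite -xi xt.
  apply: vi; rewrite -{}[RHS]tc.
  under eq_bigr => l _ do rewrite (fun_if (fun z => v l *~ z)) mulr0z.
  rewrite -big_mkcond -(big_map v (fun z => z \in t) (fun z => z *~ c z)) -big_filter.
  apply: perm_big; apply: uniq_perm => //.
    by rewrite filter_uniq // map_inj_uniq // index_enum_uniq.
  move=> z; rewrite mem_filter andb_idr // => zt.
  by have /codomP[j ->] : z \in codom v by [exact: ts]; rewrite map_f ?mem_index_enum.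
move=> s su si; apply: (indep_leq (w := fun i : 'I_(size s) => nth 0 s i) vs) => c hc i.
have := si s (fun x => if insub (index x s) is Some j then c j else 0) su (fun x => id).
rewrite (big_nth 0) big_mkord => /(_ _ _ (mem_nth 0 (ltn_ord i))).
rewrite index_uniq // valK; apply; rewrite -[RHS]hc.
by apply: eq_bigr => j _; rewrite index_uniq // valK.
Qed.

Section Exact.
Variables (A B C : zmodType) (i : {additive A -> B}) (p : {additive B -> C}).
Hypotheses (iI : injective i) (pS : forall z, exists y, p y = z).
Hypothesis ipE : forall y, p y = 0 <-> exists x, i x = y.

Lemma indep_inj r (v : 'I_r -> A) : indep v -> indep (i \o v).
Proof.
move=> vi c hc; apply: vi; apply: iI; rewrite raddf_sum raddf0 -{}[RHS]hc.
by apply: eq_bigr => j _; rewrite raddfMz.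
Qed.

Lemma indep_lift r (v : 'I_r -> B) : indep (p \o v) -> indep v.
Proof.
move=> vi c hc; apply: vi; rewrite -[RHS](raddf0 p) -hc raddf_sum.
by apply: eq_bigr => j _; rewrite raddfMz.
Qed.

(** The image of a rational basis of [A] together with lifts [w'] of one of [C] is a rational basis
    of [B]. *)
Lemma qrank_extension a c : qrank A a -> qrank C c -> qrank B (a + c).
Proof.
move=> [v [vi vs]] [w [wi ws]].
have /choice[w' w'E] j := pS (w j).
pose z (j : 'I_(a + c)) :=
  match fintype.split j with inl k => i (v k) | inr k => w' k end.
have splitE (d : 'I_(a + c) -> int) : \sum_j z j *~ d j
    = i (\sum_k v k *~ d (lshift c k)) + \sum_k w' k *~ d (rshift a k).
  rewrite big_split_ord raddf_sum; congr (_ + _); apply: eq_bigr => k _.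
    by rewrite /z (unsplitK (inl k)) raddfMz.
  by rewrite /z (unsplitK (inr k)).
have pi0 x : p (i x) = 0 by apply: (ipE _).2; exists x.
have pw (d : 'I_c -> int) : p (\sum_k w' k *~ d k) = \sum_k w k *~ d k.
  by rewrite raddf_sum; apply: eq_bigr => k _; rewrite raddfMz w'E.
exists z.
split=> [d|y].
  rewrite splitE => hd.
  have d2 : forall k, d (rshift a k) = 0.
    apply: wi; have := congr1 p hd.
    by rewrite raddfD pi0 add0r pw raddf0.
  have d1 : forall k, d (lshift c k) = 0.
    apply: vi; apply: iI; move: hd; rewrite [X in _ + X]big1 ?addr0 ?raddf0 // => k _.
    by rewrite d2 mulr0z.
  by move=> j; rewrite -(splitK j); case: (fintype.split j).
have [k k0 [d dE]] := ws (p y).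
have : p (y *~ k - \sum_l w' l *~ d l) = 0.
  by rewrite raddfB raddfMz pw dE subrr.
move=> /ipE[x xE]; have [k' k'0 [e eE]] := vs x.
(* [k] brings the image of [y] into the span of [w], and [k'] then brings the remainder, which comes
   from [A], into the span of [v]. *)
exists (k * k'); first by rewrite mulf_neq0.
exists (fun j => match fintype.split j with inl l => e l | inr l => d l * k' end).
rewrite splitE.
under eq_bigr => l _ do rewrite (unsplitK (inl l)).
under [X in _ + X]eq_bigr => l _ do rewrite (unsplitK (inr l)) mulrzA.
rewrite -eE raddfMz xE -mulrz_suml mulrzA -mulrzDl.
by rewrite subrK.
Qed.

Lemma qrank_exact b : qrank B b -> 
  exists a c, [/\ qrank A a, qrank C c & (a + c = b)%N].
Proof.
move=> bB; have [v [vi vs]] := bB.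
have [a _ aA] : exists2 a, (a <= b)%N & qrank A a.
  by apply: qrank_bounded => m w /indep_inj; exact: indep_leq.
have [c _ cC] : exists2 c, (c <= b)%N & qrank C c.
  apply: qrank_bounded => m w wi; have /choice[w' w'E] j := pS (w j).
  apply: (indep_leq (w := w') vs); apply: indep_lift.
  by rewrite (_ : p \o w' = w) //; apply: funext.
by exists a, c; split=> //; exact: qrank_unique (qrank_extension aA cC) bB.
Qed.

End Exact.

Lemma qrank_sub A B (i : {additive A -> B}) b : injective i -> qrank B b ->
  exists2 a, (a <= b)%N & qrank A a.
Proof.
move=> iI [v [_ vs]]; apply: qrank_bounded => m w /(indep_inj iI).
exact: indep_leq.
Qed.

(** The image of a rational basis of [A] is an independent family of maximal length in [B], hence
    spans up to torsion. *)
Lemma qrank_inj_torsion A B (i : {additive A -> B}) r : injective i ->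
  qrank A r -> qrank B r -> forall y, exists2 k : int, k != 0 & exists x, i x = y *~ k.
Proof.
move=> iI [v [vi vs]] [w [wi ws]] y.
have /(_ y)[k k0 [c cE]] : qspan (i \o v).
  by apply: indep_max (indep_inj iI vi) _ => m w'; exact: indep_leq.
exists k => //; exists (\sum_j v j *~ c j); rewrite cE raddf_sum.
by apply: eq_bigr => j _; rewrite raddfMz.
Qed.

End RankTheory.

Lemma dfun_choice (I : Type) (T : I -> Type) (R : forall i, T i -> Prop) :
  (forall i, exists x, R i x) -> exists f : forall i, T i, forall i, R i (f i).
Proof. by move=> h; exists (fun i => projT1 (cid (h i))) => i; exact: projT2. Qed.

Definition torsionfree (M : zmodType) :=
  forall (x : M) (k : int), k != 0 -> x *~ k = 0 -> x = 0.

Lemma qrank0_trivial (M : zmodType) : torsionfree M -> qrank M 0 -> forall x : M, x = 0.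
Proof.
move=> tM [v [_ vs]] x; have [k k0 [c]] := vs x; rewrite big_ord0.
exact: tM.
Qed.

(** [B] is the product of the [M i] over [s], seen through its evaluations. Splitting off one factor
    leaves the kernel of [ev i], to which the induction hypothesis applies. *)
Lemma qrank_joint_seq (I : eqType) (M : I -> zmodType) (r : I -> nat) (s : seq I)
    (B : zmodType) (ev : forall i, {additive B -> M i}) :
  uniq s -> (forall i, i \in s -> qrank (M i) (r i)) ->
  (forall x, (forall i, i \in s -> ev i x = 0) -> x = 0) ->
  (forall y : dprod M, exists x, forall i, i \in s -> ev i x = y i) ->
  qrank B (\sum_(i <- s) r i).
Proof.
elim: s B ev => [|i s IHs] B ev.
  move=> _ _ B0 _; rewrite big_nil; exists (fun=> 0).
  by split=> [c _ []//|x]; exists 1 => //; exists (fun=> 0); rewrite big_ord0; exact: B0.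
rewrite cons_uniq => /andP[nis us] Mr evI evS; rewrite big_cons addnC.
have val_inj' : injective (val : kernel (ev i) -> B) by exact: val_inj.
apply: (qrank_extension (i := val : {additive kernel (ev i) -> B}) (p := ev i)) => //.
- move=> z; have [x xE] := evS (dfwith (fun=> 0) z).
  by exists x; rewrite xE ?mem_head // dfwith_in.
- move=> y; split=> [/eqP yK|[x <-]]; last exact/eqP/(valP x).
  by exists (exist (fun z => z \in kerp (ev i)) y yK).
- apply: (IHs (kernel (ev i)) (fun j => ev j \o val : {additive _ -> _})) => //.
  + by move=> j js; apply: Mr; rewrite inE js orbT.
  + move=> x xE; apply: val_inj'; rewrite raddf0; apply: evI => j.
    by rewrite inE => /predU1P[->|/xE//]; exact/eqP/(valP x).
  move=> y; have [x xE] := evS (dfwith y (0 : M i)).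
  have xK : x \in kerp (ev i) by apply/eqP; rewrite xE ?mem_head // dfwith_in.
  exists (exist (fun z => z \in kerp (ev i)) x xK) => j js /=.
  rewrite xE ?inE ?js ?orbT // dfwith_out //.
  by apply: contraNneq nis => ->.
- by apply: Mr; rewrite mem_head.
Qed.

(** [A] may be infinite: torsion-free factors of rank 0 vanish, so only the finitely many others
    count. *)
Lemma qrank_joint (I : choiceType) (M : I -> zmodType) (rk : I -> int) (A : set I)
    (B : zmodType) (ev : forall i, {additive B -> M i}) :
  (forall i, A i -> exists2 r, qrank (M i) r & r%:Z = rk i) ->
  (forall i, A i -> torsionfree (M i)) ->
  finite_set [set i | A i /\ rk i <> 0] ->
  (forall x, (forall i, A i -> ev i x = 0) -> x = 0) ->
  (forall y : dprod M, exists x, forall i, A i -> ev i x = y i) ->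
  exists2 r, qrank B r & r%:Z = \sum_(i \in A) rk i.
Proof.
move=> Mr Mt fA evI evS; set S := [set i | _]%classic in fA.
have SP i : i \in fset_set S -> A i /\ rk i <> 0.
  by rewrite in_fset_set // inE.
have rP i : exists r, A i -> qrank (M i) r /\ r%:Z = rk i.
  by have [/Mr[r]|nA] := pselect (A i); [exists r | exists 0%N].
have /choice[r rE] := rP.
exists (\sum_(i <- fset_set S) r i)%N.
  apply: (qrank_joint_seq (ev := ev)) => //.
  - by move=> i /SP[/rE[]].
  - move=> x xE; apply: evI => i Ai.
    have [rk0|/eqP rk0] := eqVneq (rk i) 0; last first.
      by apply: xE; rewrite in_fset_set // inE.
    have [Mi] := rE _ Ai; rewrite rk0 => -[ri].
    by rewrite ri in Mi; apply: qrank0_trivial (Mt _ Ai) Mi _.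
  - by move=> y; have [x xE] := evS y; exists x => i /SP[/xE].
have -> : \sum_(i \in A) rk i = \sum_(i \in S) rk i.
  apply/esym/fsbig_widen => [i []//|i [Ai /not_andP[//|/contrapT]]].
  exact.
rewrite fsbig_finite // -natz natr_sum; apply: eq_big_seq => i /SP[/rE[_ <-] _].
exact: natz.
Qed.

(** * Coordinates of products of values of a functor *)

Section ProductEvaluation.
Variables (disp : Order.disp_t) (P : porderType disp) (F : pfunctor P).
Variables (A : set P) (p : P).

(** The default 0 outside [A] makes the coordinate total in [p], so that it carries no membership
    proof. *)
Definition prod_eval_fun (x : prodF F A) : F p :=
  match pselect (A p) with
  | left Ap => x (exist _ p (mem_set Ap))
  | right _ => 0
  end.

Lemma prod_eval_zmod : zmod_morphism prod_eval_fun.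
Proof.
by move=> x y; rewrite /prod_eval_fun; case: pselect => // _; rewrite subr0.
Qed.

Definition prod_eval : {additive prodF F A -> F p} :=
  HB.pack prod_eval_fun
    (GRing.isZmodMorphism.Build _ _ prod_eval_fun prod_eval_zmod).

End ProductEvaluation.

Section ProductEvaluationTheory.
Variables (disp : Order.disp_t) (P : porderType disp) (F : pfunctor P).
Implicit Types A B : set P.

Lemma prod_evalE A (x : prodF F A) (p : A) : prod_eval F A (val p) x = x p.
Proof.
case: p => p Ap; rewrite /= /prod_eval_fun; case: pselect => [Ap'|[]];
  last exact: set_mem.
by congr (x (exist _ p _)); exact: bool_irrelevance.
Qed.

Lemma prodF_ext A (x y : prodF F A) :
  (forall p, A p -> prod_eval F A p x = prod_eval F A p y) -> x = y.
Proof.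
move=> xy; apply: functional_extensionality_dep => p.
by rewrite -!prod_evalE; exact/xy/set_mem/(valP p).
Qed.

Definition prod_restr A (y : dprod F) : prodF F A := fun p => y (val p).
Arguments prod_restr : clear implicits.

Lemma prod_eval_restr A (y : dprod F) p : A p -> prod_eval F A p (prod_restr A y) = y p.
Proof. by move=> Ap; rewrite /= /prod_eval_fun; case: pselect. Qed.

Lemma prod_eval_proj A B (h : (A `<=` B)%classic) (x : prodF F B) p : A p ->
  prod_eval F A p (prod_proj F h x) = prod_eval F B p x.
Proof.
move=> Ap; pose q : A := exist _ p (mem_set Ap).
by rewrite (prod_evalE _ q) (prod_evalE x (set_incl h q)).
Qed.

Lemma qrank_prodF A (rk : P -> int) :
  (forall p, A p -> exists2 r, qrank (F p) r & r%:Z = rk p) ->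
  (forall p, A p -> torsionfree (F p)) ->
  finite_set [set p | A p /\ rk p <> 0] ->
  exists2 r, qrank (prodF F A) r & r%:Z = \sum_(p \in A) rk p.
Proof.
move=> Fr Ft fA; apply: (qrank_joint Fr Ft fA (ev := prod_eval F A)).
  by move=> x x0; apply: prodF_ext => p /x0->; rewrite raddf0.
by move=> y; exists (prod_restr A y) => p; exact: prod_eval_restr.
Qed.

Variable deg : P -> nat.

Lemma prod_eval_unit n p q (h : (p <= q)%O) (x : F p) : deg q = n ->
  prod_eval F (up deg p n) q (unit_hom deg n F p x) = fmap F h x.
Proof.
move=> dq; rewrite /= /prod_eval_fun; case: pselect => [A|[]//].
by rewrite /unit_fun /to_prodF /=; congr (fmap F _ x); exact: bool_irrelevance.
Qed.

End ProductEvaluationTheory.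
Arguments prod_restr {disp P F} A y.

(** * The functors F_n *)

Lemma coker_pi_eq0 (A B : zmodType) (f : {additive A -> B}) (y : B) :
  coker_pi f y = 0 <-> exists x, f x = y.
Proof. by rewrite -(raddf0 (coker_pi f)) coker_piP subr0. Qed.

Lemma coker_piS (A B : zmodType) (f : {additive A -> B}) (z : cokernel f) :
  exists y, coker_pi f y = z.
Proof. by exists (repr z); exact: coker_pi_repr. Qed.

Section Graded.
Variables (disp : Order.disp_t) (P : porderType disp) (deg : P -> nat).
Hypothesis hdeg : graded deg.

(** The axioms compare degrees strictly only for covering pairs. Finiteness above [p] allows
    induction on the number of elements of that set lying below the upper endpoint. *)
Lemma graded_lt (p q : P) : (p < q)%O -> (deg q < deg p)%N.
Proof.
have /finite_seqP[s sE] := graded_finite hdeg p.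
have sP r : (p <= r)%O -> r \in s by move=> pr; have : [set` s]%classic r by rewrite -sE.
suff aux m r q' : (p <= r)%O -> (count (fun t => t < q')%O s < m)%N -> (r < q')%O ->
    (deg q' < deg r)%N by exact: aux (lexx p) (ltnSn _).
elim: m r q' => // m IHm r {}q pr hm rq.
have [[t rt tq]|h] := pselect (exists2 t, (r < t)%O & (t < q)%O).
  apply: leq_ltn_trans (graded_rev hdeg (ltW tq)) (IHm _ _ pr _ rt).
  rewrite ltnS in hm; apply: leq_trans hm; rewrite -[X in (_ < X)%N]size_filter.
  rewrite -(count_predC (fun u => u < t)%O) count_filter -addn1 leq_add //.
    apply/eq_leq/eq_count => u /=; rewrite andb_idr // => ut; exact: lt_trans tq.
  (* [t] itself is counted below [q] but not below [t], so the count drops. *)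
  rewrite -has_count; apply/hasP; exists t; last by rewrite /= ltxx.
  by rewrite mem_filter tq sP // (le_trans pr) // ltW.
rewrite (@graded_cover _ _ _ hdeg r q) //; split=> // t rt tq.
move: rt; rewrite le_eqVlt => /predU1P[->|rt]; first by left.
move: tq; rewrite le_eqVlt => /predU1P[->|tq]; first by right.
by case: h; exists t.
Qed.

Lemma finite_up p n : finite_set (up deg p n).
Proof. by apply: sub_finite_set (graded_finite hdeg p) => q []. Qed.

Lemma graded_eq (p q : P) : (p <= q)%O -> deg q = deg p -> q = p.
Proof.
by rewrite le_eqVlt => /predU1P[//|/graded_lt/[swap]->]; rewrite ltnn.
Qed.

Notation F := (Fn deg).

Lemma next_mapE n (p q : P) (h : (p <= q)%O) x :
  fmap (F n.+1) h (coker_pi (unit_hom deg n (F n) p) x)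
  = coker_pi (unit_hom deg n (F n) q) (prod_proj (F n) (up_sub h) x).
Proof. exact: (coker_mapE (@unit_compat _ _ deg n (F n) _ _ h) x). Qed.

(** For [deg p <= n] the set [up deg p n] is empty or consists of [p] alone; in the latter case the
    unit map is the identity of [F n p]. Either way its cokernel is zero. *)
Lemma Fn_low n p : (deg p < n)%N -> forall x : F n p, x = 0.
Proof.
case: n => // n; rewrite ltnS => dp x; have [y <-] := coker_piS x.
apply/coker_pi_eq0; exists (prod_eval (F n) (up deg p n) p y).
apply: prodF_ext => q [pq dq].
rewrite (prod_eval_unit pq) //.
have dpn : deg p = n by apply/eqP; rewrite eqn_leq dp -dq graded_rev.
have qp : q = p by apply: graded_eq => //; rewrite dq.
by rewrite {q dq}qp in pq *; exact: fmap_id.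
Qed.

Variables (J : P -> nat -> set P).
Hypotheses (hJ : local_covering_family deg J) (hJa : adequate deg J).

Let JS p n : (n <= deg p)%N -> (J p n `<=` up deg p n)%classic.
Proof. by case: hJ => h _ _; exact: h. Qed.

(* The restriction of [F n p] to the product over [J p n] has torsion-free
   cokernel ([k != 0]) and is injective ([k = 0]). *)
Definition local_div n := forall p, (n < deg p)%N -> forall (k : int) (x : F n p),
  (forall q (h : (p <= q)%O), J p n q -> exists y, fmap (F n) h x = y *~ k) ->
  exists y, x = y *~ k.

Definition local_rank n := forall p, (n <= deg p)%N ->
  torsionfree (F n p) /\ exists2 r, qrank (F n p) r & r%:Z = Rnum deg n p.

Definition local_surj n := forall p, (n < deg p)%N -> forall y : dprod (F n),
  exists x, forall q (h : (p <= q)%O), J p n q -> fmap (F n) h x = y q.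

Lemma local_div_inj n p : local_div n -> (n < deg p)%N -> forall (x : F n p),
  (forall q (h : (p <= q)%O), J p n q -> fmap (F n) h x = 0) -> x = 0.
Proof.
move=> dv np x hx; have [|y ->] := dv p np 0 x; last exact: mulr0z.
by move=> q h Jq; exists 0; rewrite hx // mulr0z.
Qed.

(** Adequacy equates the rank of [F n p] with that of the product over [J p n]. The restriction is
    injective, so its cokernel is torsion; [local_div] makes the cokernel torsion-free, hence
    zero. *)
Lemma local_surjP n : local_div n -> local_rank n -> local_surj n.
Proof.
move=> dv rk p np y.
have JpS := JS (ltnW np).
pose i : {additive F n p -> prodF (F n) (J p n)} :=
  prod_proj (F n) JpS \o unit_hom deg n (F n) p.
have iE x q (h : (p <= q)%O) : J p n q ->
    prod_eval (F n) (J p n) q (i x) = fmap (F n) h x.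
  move=> Jq; transitivity (prod_eval (F n) (up deg p n) q (unit_hom deg n (F n) p x)).
    exact: prod_eval_proj.
  by apply: prod_eval_unit; have [] := JpS _ Jq.
have iI : injective i.
  apply: raddf_inj => x ix0; apply: (local_div_inj dv np) => q h Jq.
  by rewrite -iE // ix0 raddf0.
have dJ q : J p n q -> (n <= deg q)%N by move=> /JpS[_ ->].
have [r Fr rE] := (rk p (ltnW np)).2.
have [r' Br' r'E] : exists2 r, qrank (prodF (F n) (J p n)) r &
    r%:Z = \sum_(q \in J p n) Rnum deg n q.
  apply: qrank_prodF; first by move=> q /dJ/rk[].
    by move=> q /dJ/rk[].
  apply: sub_finite_set (finite_up p n) => q [/JpS]//.
have rr' : r = r' by apply/eqP; rewrite -eqz_nat rE r'E -hJa.2.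
rewrite -rr' in Br'.
have [k k0 [x xE]] := qrank_inj_torsion iI Fr Br' (prod_restr _ y).
have [|w xw] := dv p np k x.
  move=> q h Jq; exists (y q).
  by rewrite -iE // xE raddfMz prod_eval_restr.
exists w => q h Jq; apply/eqP; rewrite -subr_eq0; apply/eqP.
apply: (rk q (dJ q Jq)).1 k0 _.
rewrite mulrzBl -raddfMz -xw -iE // xE raddfMz prod_eval_restr //.
exact: subrr.
Qed.

(** Three cases: above degree [n] the coordinates in [J p n] already detect elements, in degree [n]
    the coordinate at [p] does, and below it [F n p] is zero. *)
Lemma local_div_unit_inj n p : local_div n -> injective (unit_hom deg n (F n) p).
Proof.
move=> dv; apply: raddf_inj => x ux.
have eq0 q (h : (p <= q)%O) : deg q = n -> fmap (F n) h x = 0.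
  by move=> dq; rewrite -(prod_eval_unit h x dq) ux raddf0.
have [np|] := ltnP n (deg p).
  by apply: (local_div_inj dv np) => q h /(JS (ltnW np))[_]; exact: eq0.
rewrite leq_eqVlt => /predU1P[dp|/Fn_low//].
by rewrite -[x](fmap_id (lexx p)); exact: eq0.
Qed.

Lemma local_rank0 : local_rank 0.
Proof.
move=> p _; split=> [x k k0 /eqP|].
  by rewrite mulrz_eq0 (negPf k0) => /eqP.
exists 1%N => //; exists (fun=> 1); split=> [c|x].
  by rewrite big_ord1 intz => c0 i; rewrite ord1.
by exists 1 => //; exists (fun=> x); rewrite big_ord1 !intz.
Qed.

Lemma local_div0 : local_div 0.
Proof.
(* The sum of ones over [J p 0] equals 1, so this set is nonempty; any restriction map of a constant
   functor is the identity. *)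
move=> p np k x hx; have [q Jq] : exists q, J p 0%N q.
  apply: contrapT => J0; have /eqP := hJa.2 _ _ np.
  rewrite [J p 0%N](_ : _ = set0) ?fsbig_set0 ?oner_eq0 //.
  by apply/eqP/negPn/negP => /set0P.
have [pq _] := JS (ltnW np) Jq.
exact: hx pq Jq.
Qed.

(** If [k] kills the class of [x'], then [x' *~ k] comes from some [y], which is divisible by [k] by
    [local_div]; the quotient maps to [x']. The rank follows from the short exact sequence defining
    [F n.+1 p]. *)
Lemma local_rankS n : local_div n -> local_rank n -> local_rank n.+1.
Proof.
move=> dv rk p np; have dup q : up deg p n q -> (n <= deg q)%N by move=> [_ ->].
split=> [x k k0 xk|].
  have [x' xE] := coker_piS x; rewrite -xE -raddfMz in xk.
  have [y yE] := (coker_pi_eq0 _ _).1 xk.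
  have ev q (h : (p <= q)%O) : deg q = n ->
      fmap (F n) h y = prod_eval (F n) (up deg p n) q x' *~ k.
    by move=> dq; rewrite -raddfMz -yE (prod_eval_unit h).
  have [|z yz] := dv p np k y.
    move=> q h /(JS (ltnW np))[_ dq]; exists (prod_eval (F n) (up deg p n) q x').
    exact: ev.
  rewrite -xE; apply/coker_pi_eq0; exists z; apply: prodF_ext => q [pq dq].
  rewrite (prod_eval_unit pq) //; apply/eqP; rewrite -subr_eq0; apply/eqP.
  apply: (rk q _).1 k0 _; first by rewrite dq.
  by rewrite mulrzBl -raddfMz -yz ev ?subrr.
have [b Bb bE] : exists2 r, qrank (prodF (F n) (up deg p n)) r &
    r%:Z = \sum_(q \in up deg p n) Rnum deg n q.
  apply: qrank_prodF; [by move=> q /dup/rk[]|by move=> q /dup/rk[]|].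
  by apply: sub_finite_set (finite_up p n) => q [].
have [a [c [Aa Cc abc]]] := qrank_exact (local_div_unit_inj (p := p) dv)
  (@coker_piS _ _ _) (@coker_pi_eq0 _ _ _) Bb.
exists c => //=; have [r Fr rE] := (rk p (ltnW np)).2.
rewrite -bE -rE -(qrank_unique Aa Fr) -abc PoszD addrC.
by rewrite addKr.
Qed.

Lemma local_divS n : local_div n -> local_surj n -> local_div n.+1.
Proof.
move=> dv sj p np k x hx; have [x' xE] := coker_piS x; rewrite -{x}xE in hx *.
have np' := ltnW np.
pose ev q := prod_eval (F n) (up deg p n) q.
(* Subtracting the image of [z] leaves the class of [x'] unchanged and makes its coordinates in
   [J p n] zero. It remains to divide every coordinate of the difference by [k]. *)
have [z zE] := sj p np' (fun q => ev q x').
have key q (h : (p <= q)%O) : deg q = n ->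
    exists w, ev q x' - fmap (F n) h z = w *~ k.
  move=> dq; have [_ cov sub] := hJ.
  (* Every [q] lies above some [r] in [J p n.+1], where the hypothesis gives divisibility up to an
     element [t] of [F n r]. *)
  have [r Jr [rq _]] : (\bigcup_(r in J p n.+1) up deg r n)%classic q by rewrite cov.
  have [pr dr] := JS np' Jr.
  have [y yE] := hx r pr Jr; have [y' y'E] := coker_piS y.
  have := yE; rewrite next_mapE -y'E -raddfMz => /coker_piP[t tE].
  have evE s (rs : (r <= s)%O) : deg s = n -> 
      fmap (F n) rs t = ev s x' - prod_eval (F n) (up deg r n) s y' *~ k.
    move=> ds; rewrite -(prod_eval_unit rs t ds) tE raddfB raddfMz.
    by rewrite prod_eval_proj.
  have nr : (n < deg r)%N by rewrite dr.
  (* As [J r n] is contained in [J p n], where [z] agrees with [x'], the ambiguity [t] differs from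
     the restriction of [z] by a multiple of [k] on [J r n], hence in [F n r]. *)
  have [|w wE] := dv r nr k (fmap (F n) pr z - t).
    move=> s rs Js; have [_ ds] := JS (ltnW nr) Js.
    exists (prod_eval (F n) (up deg r n) s y').
    rewrite raddfB evE // (fmap_comp _ _ (le_trans pr rs)) zE.
      by rewrite opprB addrC subrK.
    exact: sub Js.
  exists (prod_eval (F n) (up deg r n) q y' - fmap (F n) rq w).
  rewrite mulrzBl -(raddfMz (fmap (F n) rq)) -wE raddfB (fmap_comp _ _ h) evE //.
  by rewrite opprB addrA (addrCA _ (ev q x')) subrr addr0.
have /dfun_choice[w wE] : forall q, exists w : F n q, up deg p n q ->
    ev q x' - prod_eval (F n) (up deg p n) q (unit_hom deg n (F n) p z) = w *~ k.
  move=> q; have [[pq dq]|nu] := pselect (up deg p n q); last by exists 0.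
  by have [w wE] := key q pq dq; exists w => _; rewrite (prod_eval_unit pq).
exists (coker_pi (unit_hom deg n (F n) p) (prod_restr _ w)).
rewrite -raddfMz; apply/coker_piP; exists z; apply: prodF_ext => q uq.
rewrite raddfB raddfMz prod_eval_restr // -wE //.
by rewrite opprB addrC subrK.
Qed.

Lemma local_structure n : local_div n /\ local_rank n.
Proof.
elim: n => [|n [dv rk]]; first by split; [exact: local_div0|exact: local_rank0].
split; last exact: local_rankS.
exact/local_divS/local_surjP.
Qed.

Lemma unit_inj n p : injective (unit_hom deg n (F n) p).
Proof. exact: local_div_unit_inj (local_structure n).1. Qed.

End Graded.

(** * Extension and lifting of sections *)

Section Sections.
Variables (disp : Order.disp_t) (P : porderType disp).
Implicit Types (A B C D : pfunctor P) (U : set P).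

Definition section_on A U (s : dprod A) :=
  forall (p q : P) (h : (p <= q)%O), U p -> fmap A h (s p) = s q.

(** Surjectivity of the map from [A p] to the limit of [A] over the elements strictly above [p];
    [flabby_ker] is the same property for the kernel of [t], without forming the kernel functor. *)
Definition flabby A := forall p (s : dprod A), section_on (strict_up p) s ->
  exists x, forall q (h : (p <= q)%O), (p < q)%O -> fmap A h x = s q.

Definition flabby_ker A B (t : nat_trans A B) :=
  forall p (s : dprod A), section_on (strict_up p) s ->
    (forall q, (p < q)%O -> t q (s q) = 0) ->
  exists2 x, t p x = 0 & forall q (h : (p <= q)%O), (p < q)%O -> fmap A h x = s q.

Definition exact_at A B C (t : nat_trans A B) (t' : nat_trans B C) :=
  forall p y, t' p y = 0 <-> exists x, t p x = y.

Variable deg : P -> nat.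
Hypothesis hdeg : graded deg.

Section Lift.
Variables (A B C : pfunctor P) (t : nat_trans A B) (t' : nat_trans B C).
Hypotheses (tK : flabby_ker t) (tt' : exact_at t t').
Variable U : set P.
Hypothesis Uup : forall p q, (p <= q)%O -> U p -> U q.
Variable c : dprod B.
Hypotheses (cU : section_on U c) (c0 : forall p, U p -> t' p (c p) = 0).

(** A lift on the elements of degree below [m]. Degree reverses the order, so all elements strictly
    above one of degree [m] are treated before it. *)
Let lifts m (b : dprod A) :=
  (forall p, U p -> (deg p < m)%N -> t p (b p) = c p) /\
  (forall p q (h : (p <= q)%O), U p -> (deg p < m)%N -> fmap A h (b p) = b q).

Let lifts_step m b : lifts m b ->
  exists b', lifts m.+1 b' /\ forall p, (deg p < m)%N -> b' p = b p.
Proof.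
move=> [bc bU].
have step p : U p -> deg p = m -> exists x, t p x = c p /\
    forall q (h : (p <= q)%O), (p < q)%O -> fmap A h x = b q.
  move=> Up dp; have [x0 x0E] := (tt' (c p)).1 (c0 Up).
  (* [s] is the failure of the preimage [x0] to restrict to [b] above [p]. It lies in the kernel of
     [t], so it extends to some [a], and [x0 - a] is the value sought. *)
  pose s : dprod A := fun q =>
    match pselect (p <= q)%O with left h => fmap A h x0 - b q | right _ => 0 end.
  have sE q (h : (p <= q)%O) : s q = fmap A h x0 - b q.
    by rewrite /s; case: pselect => // h'; rewrite (bool_irrelevance h h').
  have lt_m q : (p < q)%O -> (deg q < m)%N by rewrite -dp; exact: graded_lt.
  have [|q pq|a a0 aE] := tK (p := p) (s := s).
  - move=> q r qr pq; rewrite (sE _ (ltW pq)) (sE _ (le_trans (ltW pq) qr)).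
    rewrite raddfB (fmap_comp _ _ (le_trans (ltW pq) qr)) bU //; last exact: lt_m.
    exact: Uup (ltW pq) Up.
  - rewrite (sE _ (ltW pq)) raddfB nt_nat x0E cU // bc ?subrr //; last exact: lt_m.
    exact: Uup (ltW pq) Up.
  exists (x0 - a); rewrite raddfB x0E a0 subr0; split=> // q h pq.
  by rewrite raddfB aE // (sE _ h) opprB addrC subrK.
(* Distinct elements of equal degree are incomparable, so the values in degree [m] can be chosen
   independently. *)
have /dfun_choice[b' b'E] : forall p, exists x, ((deg p < m)%N -> x = b p) /\
    (U p -> deg p = m -> t p x = c p /\
    forall q (h : (p <= q)%O), (p < q)%O -> fmap A h x = b q).
  move=> p; have [[Up dp]|nU] := pselect (U p /\ deg p = m).
    by have [x xE] := step p Up dp; exists x; split=> //; rewrite dp ltnn.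
  by exists (b p); split=> // Up dp; case: nU.
exists b'; split; last by move=> p /(b'E p).1.
split=> [p Up|p q h Up].
  rewrite ltnS leq_eqVlt => /predU1P[dp|dp]; first by have [] := (b'E p).2 Up dp.
  by rewrite (b'E p).1 // bc.
have := h; rewrite le_eqVlt => /predU1P[pq|pq].
  by case: q / pq h => h _; exact: fmap_id.
rewrite ltnS leq_eqVlt => /predU1P[dp|dp].
  rewrite ((b'E p).2 Up dp).2 // (b'E q).1 // -dp; exact: graded_lt.
rewrite (b'E p).1 // (b'E q).1 ?bU //.
exact: leq_ltn_trans (graded_rev hdeg h) dp.
Qed.

Lemma section_lift : exists2 b : dprod A, section_on U b &
  forall p, U p -> t p (b p) = c p.
Proof.
have lifts0 : lifts 0 (fun=> 0) by [].
(* Later stages keep earlier values, so the limit takes its value at [p] from stage [(deg p).+1]. *)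
pose next m (b : {b | lifts m b}) : {b | lifts m.+1 b} :=
  let w := cid (lifts_step (svalP b)) in exist _ (sval w) (svalP w).1.
pose bs := nat_rect (fun m => {b | lifts m b}) (exist _ _ lifts0) next.
pose b m p := sval (bs m) p.
have bS m p : (deg p < m)%N -> b m.+1 p = b m p.
  by move=> dp; exact: (svalP (cid (lifts_step (svalP (bs m))))).2.
have bE m p : (deg p < m)%N -> b m p = b (deg p).+1 p.
  elim: m => // m IHm; rewrite ltnS leq_eqVlt => /predU1P[->//|dp].
  by rewrite bS // IHm.
exists (fun p => b (deg p).+1 p) => [p q h Up|p Up].
  have [_ ->//] := svalP (bs (deg p).+1).
  by rewrite -/(b _ _) bE // ltnS graded_rev.
by have [->] := svalP (bs (deg p).+1).
Qed.

End Lift.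

(** Dimension shifting: a section of the kernel of [t'] lifts to a section of [A], which extends to
    [p] and is mapped back. *)
Lemma flabby_ker_next A B C (t : nat_trans A B) (t' : nat_trans B C) :
  flabby A -> flabby_ker t -> exact_at t t' -> flabby_ker t'.
Proof.
move=> Af tK tt' p s sU s0.
have up_p q r : (q <= r)%O -> strict_up p q -> strict_up p r.
  by move=> qr pq; exact: lt_le_trans qr.
have [b bU bE] := section_lift tK tt' up_p sU s0.
have [x xE] := Af p b bU.
exists (t p x); first by apply/tt'; exists x.
by move=> q h pq; rewrite -nt_nat xE // bE.
Qed.

End Sections.

(** * Injective functors are flabby *)

Section SupportedConstant.
Variables (disp : Order.disp_t) (P : porderType disp) (S : set P).
Hypothesis Sup : forall p q, (p <= q)%O -> S p -> S q.

Definition supported (p : P) : {pred int} := fun x => `[< S p >] || (x == 0).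

Lemma supported_closed p : zmod_closed (supported p).
Proof.
split=> [|x y]; rewrite !unfold_in /supported ?eqxx ?orbT //.
by case: asboolP => //= _ /eqP-> /eqP->; rewrite subr0.
Qed.
HB.instance Definition _ p :=
  GRing.isZmodClosed.Build int (supported p) (supported_closed p).

Lemma supported_le p q (h : (p <= q)%O) (x : subzmod (supported p)) :
  val x \in supported q.
Proof.
have := valP x; rewrite !unfold_in /supported.
case: asboolP => [/(Sup h) Sq _|_ /= /eqP->].
  by rewrite asboolT.
by rewrite eqxx orbT.
Qed.

Definition supported_map_fun p q (h : (p <= q)%O) (x : subzmod (supported p)) :
  subzmod (supported q) := exist (fun y => y \in supported q) _ (supported_le h x).

Lemma supported_map_zmod p q (h : (p <= q)%O) : zmod_morphism (supported_map_fun h).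
Proof. by move=> x y; exact: val_inj. Qed.

Definition supported_map p q (h : (p <= q)%O) :
    {additive subzmod (supported p) -> subzmod (supported q)} :=
  HB.pack (supported_map_fun h)
    (GRing.isZmodMorphism.Build _ _ (supported_map_fun h) (supported_map_zmod h)).

(* The constant functor Z on the up-closed set [S], extended by zero. *)
Definition const_on : pfunctor P.
Proof.
refine (@PFunctor _ P (fun p => subzmod (supported p)) supported_map _ _).
  by move=> p h x; exact: val_inj.
by move=> p q r hpq hqr hpr x; exact: val_inj.
Defined.

Lemma const_on_zero p (x : const_on p) : ~ S p -> val x = 0.
Proof.
by have := valP x; rewrite !unfold_in /supported; case: asboolP => //= _ /eqP.
Qed.

Lemma one_supported p : S p -> 1 \in supported p.
Proof. by move=> Sp; rewrite unfold_in /supported asboolT. Qed.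

Definition const_one p (Sp : S p) : const_on p :=
  exist (fun x => x \in supported p) 1 (one_supported Sp).

End SupportedConstant.

Section Injective.
Variables (disp : Order.disp_t) (P : porderType disp) (A : pfunctor P).

Section Section.
Variables (S : set P) (Sup : forall p q, (p <= q)%O -> S p -> S q).
Variables (s : dprod A) (sS : section_on S s).

Definition section_nt_fun p (x : const_on Sup p) : A p := s p *~ val x.

Lemma section_nt_zmod p : zmod_morphism (@section_nt_fun p).
Proof. by move=> x y; exact: mulrzBr. Qed.

Definition section_nt : nat_trans (const_on Sup) A.
Proof.
refine (@NatTrans _ _ (const_on Sup) A (fun p => HB.pack (@section_nt_fun p)
  (GRing.isZmodMorphism.Build _ _ (@section_nt_fun p) (@section_nt_zmod p))) _).
move=> p q h x; rewrite /= /section_nt_fun raddfMz.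
have [Sp|nSp] := pselect (S p); first by rewrite sS.
by rewrite /= (const_on_zero x nSp) !mulr0z.
Defined.

End Section.

Section Inclusion.
Variables (S S' : set P) (Sup : forall p q, (p <= q)%O -> S p -> S q).
Variables (Sup' : forall p q, (p <= q)%O -> S' p -> S' q) (SS' : (S `<=` S')%classic).

Lemma const_incl_subproof p (x : const_on Sup p) : val x \in supported S' p.
Proof.
have := valP x; rewrite !unfold_in /supported.
by case: asboolP => [/SS' Sp _|_ /= /eqP->]; [rewrite asboolT | rewrite eqxx orbT].
Qed.

Definition const_incl_fun p (x : const_on Sup p) : const_on Sup' p :=
  exist (fun y => y \in supported S' p) _ (const_incl_subproof x).

Lemma const_incl_zmod p : zmod_morphism (@const_incl_fun p).
Proof. by move=> x y; exact: val_inj. Qed.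

Definition const_incl : nat_trans (const_on Sup) (const_on Sup').
Proof.
refine (@NatTrans _ _ _ _ (fun p => HB.pack (@const_incl_fun p)
  (GRing.isZmodMorphism.Build _ _ (@const_incl_fun p) (@const_incl_zmod p))) _).
by move=> p q h x; exact: val_inj.
Defined.

End Inclusion.

(** A section over an up-closed set is a map from the constant functor supported there. Extending it
    from the elements strictly above [p] to all elements above [p] and evaluating at 1 gives the
    value at [p]. *)
Lemma injective_flabby : injective_functor A -> flabby A.
Proof.
move=> Ai p s ss.
have Sup q r : (q <= r)%O -> strict_up p q -> strict_up p r.
  by move=> qr pq; exact: lt_le_trans qr.
have Sup' q r : (q <= r)%O -> (p <= q)%O -> (p <= r)%O.
  by move=> qr pq; exact: le_trans qr.
pose S' : set P := fun q => (p <= q)%O.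
have SS' : (strict_up p `<=` S')%classic by move=> q; exact: ltW.
pose incl := const_incl Sup (Sup' : forall q r, _ -> S' q -> S' r) SS'.
have inclI q : injective (incl q).
  by move=> x y xy; apply: val_inj; exact: (congr1 (fun z => val z) xy).
have [w wE] := Ai _ _ incl (section_nt Sup ss) inclI.
exists (w p (const_one _ (lexx p : S' p))) => q h pq.
rewrite -nt_nat -[RHS](mulr1z (s q)).
rewrite -[RHS]/(section_nt Sup ss q (const_one Sup pq)) -wE.
by congr (w q _); exact: val_inj.
Qed.

End Injective.

(** * Pairs and products over upper sets as flabby functors *)

Section PairFunctor.
Variables (disp : Order.disp_t) (P : porderType disp) (A B : pfunctor P).

Definition pair_map_fun p q (h : (p <= q)%O) (x : A p * B p) : A q * B q :=
  (fmap A h x.1, fmap B h x.2).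
Lemma pair_map_zmod p q (h : (p <= q)%O) : zmod_morphism (pair_map_fun h).
Proof. by move=> x y; rewrite /pair_map_fun !raddfB. Qed.

Definition pair_functor : pfunctor P.
Proof.
refine (@PFunctor _ P (fun p => (A p * B p)%type) (fun p q h => HB.pack (pair_map_fun h)
  (GRing.isZmodMorphism.Build _ _ (pair_map_fun h) (pair_map_zmod h))) _ _).
  by move=> p h [x y]; rewrite /= /pair_map_fun !fmap_id.
by move=> p q r hpq hqr hpr x; rewrite /= /pair_map_fun /= !(fmap_comp _ _ hpr).
Defined.

Lemma pair_flabby : flabby A -> flabby B -> flabby pair_functor.
Proof.
move=> Af Bf p s ss.
have [|x xE] := Af p (fun q => (s q).1); first by move=> q r h pq; rewrite -(ss q r h pq).
have [|y yE] := Bf p (fun q => (s q).2); first by move=> q r h pq; rewrite -(ss q r h pq).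
by exists (x, y) => q h pq; rewrite /= /pair_map_fun /= xE // yE // -surjective_pairing.
Qed.

End PairFunctor.

Section UpProduct.
Variables (disp : Order.disp_t) (P : porderType disp) (deg : P -> nat).
Variables (n : nat) (A : pfunctor P).

Definition up_product : pfunctor P.
Proof.
refine (@PFunctor _ P (fun p => prodF A (up deg p n))
  (fun p q h => prod_proj A (up_sub h)) _ _).
  by move=> p h x; apply: prodF_ext => q uq; rewrite prod_eval_proj.
move=> p q r hpq hqr hpr x; apply: prodF_ext => t ut.
by rewrite !prod_eval_proj //; exact: up_sub ut.
Defined.

Lemma up_product_flabby : flabby up_product.
Proof.
(* The coordinate at [r] is taken from [s r]. If [r = p] it is arbitrary, but no [q] strictly above
   [p] sees it. *)
move=> p s ss; exists (prod_restr _ (fun r => prod_eval A (up deg r n) r (s r))).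
move=> q h pq; apply: prodF_ext => r ur; have [qr dr] := ur.
rewrite prod_eval_proj // prod_eval_restr; last exact: up_sub ur.
by rewrite -(ss q r qr pq) prod_eval_proj.
Qed.

Definition unit_nt : nat_trans A up_product.
Proof.
refine (@NatTrans _ _ A up_product (unit_hom deg n A) _).
move=> p q h x; apply: prodF_ext => r [qr dr]; rewrite prod_eval_proj //.
rewrite (prod_eval_unit qr) // (prod_eval_unit (le_trans h qr)) //.
exact: fmap_comp.
Defined.

Definition proj_nt : nat_trans up_product (next_functor deg n A).
Proof.
refine (@NatTrans _ _ up_product (next_functor deg n A)
  (fun p => coker_pi (unit_hom deg n A p)) _).
by move=> p q h x; rewrite [RHS](coker_mapE (@unit_compat _ _ deg n A _ _ h) x).
Defined.

End UpProduct.

Section NaturalTransformations.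
Variables (disp : Order.disp_t) (P : porderType disp).

Definition nt_comp (A B C : pfunctor P) (t : nat_trans A B) (t' : nat_trans B C) :
  nat_trans A C.
Proof.
refine (@NatTrans _ _ A C (fun p => (t' p \o t p)%FUN) _).
by move=> p q h x; rewrite /= !nt_nat.
Defined.

End NaturalTransformations.

(** * Comparison with an injective resolution *)

Section CokernelDescent.
Variables (A B C : zmodType) (f : {additive A -> B}) (g : {additive B -> C}).
Hypothesis gf : forall x, g (f x) = 0.

Definition coker_desc_fun (z : cokernel f) : C := g (repr z).

Lemma coker_desc_funE y : coker_desc_fun (coker_pi f y) = g y.
Proof.
have [x xE] := (coker_piP f _ _).1 (coker_pi_repr (coker_pi f y)).
by apply/eqP; rewrite -subr_eq0 -raddfB -xE gf.
Qed.

Lemma coker_desc_zmod : zmod_morphism coker_desc_fun.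
Proof.
move=> x y; rewrite -(coker_pi_repr x) -(coker_pi_repr y) -raddfB !coker_desc_funE.
exact: raddfB.
Qed.

Definition coker_desc : {additive cokernel f -> C} :=
  HB.pack coker_desc_fun (GRing.isZmodMorphism.Build _ _ coker_desc_fun coker_desc_zmod).

End CokernelDescent.

Section LimitSections.
Variables (disp : Order.disp_t) (P : porderType disp).
Implicit Types A B : pfunctor P.

Lemma lim_section A (x : limF A) : section_on setT (val x).
Proof. by move=> p q h _; have /asboolP := valP x; exact. Qed.

Lemma lim_of_section_subproof A (s : dprod A) : section_on setT s -> s \in @limp _ P A.
Proof. by move=> ss; apply/asboolP => p q h; exact: ss. Qed.

Definition lim_of_section A (s : dprod A) (ss : section_on setT s) : limF A :=
  exist (fun y => y \in @limp _ P A) s (lim_of_section_subproof ss).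

Lemma lim_ext A (x y : limF A) : (forall p, val x p = val y p) -> x = y.
Proof. by move=> xy; apply: val_inj; exact: functional_extensionality_dep. Qed.

(** Left exactness of the limit: pointwise preimages are unique by injectivity, hence compatible. *)
Lemma lim_map_exact A B (C : pfunctor P) (t : nat_trans A B) (t' : nat_trans B C) :
  (forall p, injective (t p)) -> exact_at t t' ->
  forall y, lim_map t' y = 0 <-> exists x, lim_map t x = y.
Proof.
move=> tI tt' y; split=> [y0|[x <-]]; last first.
  by apply: lim_ext => p; apply/(tt' p); exists (val x p).
have /dfun_choice[s sE] p : exists x, t p x = val y p.
  by apply/(tt' p); rewrite -[RHS]/(val (0 : limF C) p) -y0.
have ss : section_on setT s.
  by move=> p q h _; apply: tI; rewrite nt_nat !sE lim_section.
by exists (lim_of_section ss); apply: lim_ext => p; exact: sE.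
Qed.

Lemma lim_map_inj A B (t : nat_trans A B) :
  (forall p, injective (t p)) -> injective (lim_map t).
Proof.
move=> tI x y xy; apply: lim_ext => p; apply: tI.
exact: (congr1 (fun z : limF B => val z p) xy).
Qed.

End LimitSections.

Section Comparison.
Variables (disp : Order.disp_t) (P : porderType disp) (deg : P -> nat).
Notation F := (Fn deg).
Notation G n := (up_product deg n (F n)).
Hypothesis uI : forall n p, injective (unit_hom deg n (F n) p).
Variable I : injective_resolution (const_functor P int).
Notation d := (ir_d I).
Notation u n p := (unit_hom deg n (F n) p).

(** Injectivity of the target extends [psi] to the product functor. Followed by the differential,
    the extension kills the image of [F n], so it descends to the cokernel [F n.+1]. *)
Lemma comparison_step n (psi : nat_trans (F n) (ir_obj I n)) :
  (forall p x, d n p (psi p x) = 0) ->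
  exists w : nat_trans (G n) (ir_obj I n) * nat_trans (F n.+1) (ir_obj I n.+1),
  [/\ forall p x, w.1 p (u n p x) = psi p x,
      forall p y, w.2 p (coker_pi (u n p) y) = d n p (w.1 p y)
    & forall p x, d n.+1 p (w.2 p x) = 0].
Proof.
move=> psi0.
have [phi phiE] := ir_injective (n := n) (u := unit_nt deg n (F n)) psi (@uI n).
have phi0 p x : (d n p \o phi p) (u n p x) = 0 by rewrite /= phiE psi0.
pose psi' p : {additive F n.+1 p -> ir_obj I n.+1 p} := coker_desc (phi0 p).
have psi'E p y : psi' p (coker_pi (u n p) y) = d n p (phi p y).
  exact: (coker_desc_funE (phi0 p)).
have psi'N p q (h : (p <= q)%O) x : psi' q (fmap (F n.+1) h x) = fmap _ h (psi' p x).
  have [y <-] := coker_piS x.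
  rewrite next_mapE (psi'E p y) -!nt_nat.
  exact: psi'E.
have psi'0 p x : d n.+1 p (psi' p x) = 0.
  have [y <-] := coker_piS x.
  by rewrite psi'E; apply/ir_exactS; exists (phi p y).
by exists (phi, NatTrans psi'N).
Qed.

Lemma comparison : exists (psi : forall n, nat_trans (F n) (ir_obj I n))
    (phi : forall n, nat_trans (G n) (ir_obj I n)),
  [/\ forall p x, psi 0%N p x = ir_aug I p x,
      forall n p x, d n p (psi n p x) = 0,
      forall n p x, phi n p (u n p x) = psi n p x
    & forall n p y, psi n.+1 p (coker_pi (u n p) y) = d n p (phi n p y)].
Proof.
pose T n := {psi : nat_trans (F n) (ir_obj I n) | forall p x, d n p (psi p x) = 0}.
have aug0 p x : d 0%N p (ir_aug I p x) = 0 by apply/ir_exact0; exists x.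
pose w n (t : T n) := cid (comparison_step (svalP t)).
have w0 n t p x : d n.+1 p ((sval (w n t)).2 p x) = 0 by have [_ _] := svalP (w n t).
pose t := nat_rect T (exist _ (ir_aug I) aug0) (fun n tn => exist _ _ (w0 n tn)).
exists (fun n => sval (t n)), (fun n => (sval (w n (t n))).1); split=> //.
- by move=> n; exact: svalP (t n).
- by move=> n; have [] := svalP (w n (t n)).
- by move=> n; have [] := svalP (w n (t n)).
Qed.
End Comparison.

(** * The mapping cone of the comparison map *)

Section Cone.
Variables (disp : Order.disp_t) (P : porderType disp) (deg : P -> nat).
Hypothesis hdeg : graded deg.
Notation F := (Fn deg).
Notation G n := (up_product deg n (F n)).
Hypothesis uI : forall n p, injective (unit_hom deg n (F n) p).
Variable I : injective_resolution (const_functor P int).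
Notation d := (ir_d I).
Notation u n := (unit_nt deg n (F n)).
Notation pr n := (proj_nt deg n (F n)).
Variables (psi : forall n, nat_trans (F n) (ir_obj I n))
  (phi : forall n, nat_trans (G n) (ir_obj I n)).
Hypotheses (psi0E : forall p x, psi 0%N p x = ir_aug I p x)
  (phi_u : forall n p x, phi n p (u n p x) = psi n p x)
  (psi_pr : forall n p y, psi n.+1 p (pr n p y) = d n p (phi n p y)).

(** The differential of the resolution of the constant functor by the product functors. *)
Definition splice n : nat_trans (G n) (G n.+1) := nt_comp (pr n) (u n.+1).

Let spliceE n p x : splice n p x = u n.+1 p (pr n p x). Proof. by []. Qed.

Let pr_eq0 n p x : pr n p x = 0 <-> exists z, u n p z = x.
Proof. exact: coker_pi_eq0. Qed.

Let u_eq0 n p x : u n p x = 0 -> x = 0.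
Proof. by move=> ux; apply: uI; rewrite [LHS]ux raddf0. Qed.

Let splice_eq0 n p x : splice n p x = 0 <-> exists z, u n p z = x.
Proof.
rewrite -pr_eq0 spliceE; split=> [/u_eq0//|->]; exact: raddf0.
Qed.

Let splice_splice n p x : splice n.+1 p (splice n p x) = 0.
Proof. by apply/splice_eq0; exists (pr n p x). Qed.

Let splice_exact n p y : splice n.+1 p y = 0 -> exists x, splice n p x = y.
Proof.
by move=> /splice_eq0[z <-]; have [x <-] := coker_piS z; exists x.
Qed.

Let phi_splice n p x : phi n.+1 p (splice n p x) = d n p (phi n p x).
Proof. by rewrite spliceE phi_u psi_pr. Qed.

Let dd n p x : d n.+1 p (d n p x) = 0.
Proof. by apply/ir_exactS; exists x. Qed.

Definition cone n : pfunctor P :=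
  if n is m.+1 then pair_functor (G m.+1) (ir_obj I m) else G 0%N.

Definition cone_d0_fun p (x : G 0%N p) : cone 1 p := (splice 0 p x, phi 0%N p x).
Lemma cone_d0_zmod p : zmod_morphism (@cone_d0_fun p).
Proof. by move=> x y; rewrite /cone_d0_fun !raddfB. Qed.
Definition cone_d0 : nat_trans (cone 0) (cone 1).
Proof.
refine (@NatTrans _ _ (cone 0) (cone 1) (fun p => HB.pack (@cone_d0_fun p)
  (GRing.isZmodMorphism.Build _ _ (@cone_d0_fun p) (@cone_d0_zmod p))) _).
by move=> p q h x; congr (_, _); exact: nt_nat.
Defined.

Definition cone_dS_fun m p (x : cone m.+1 p) : cone m.+2 p :=
  (splice m.+1 p x.1, phi m.+1 p x.1 - d m p x.2).
Lemma cone_dS_zmod m p : zmod_morphism (@cone_dS_fun m p).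
Proof.
move=> x y; rewrite /cone_dS_fun !raddfB; congr (_, _).
by rewrite /= !opprD !opprK addrACA.
Qed.
Definition cone_dS m : nat_trans (cone m.+1) (cone m.+2).
Proof.
refine (@NatTrans _ _ (cone m.+1) (cone m.+2) (fun p => HB.pack (@cone_dS_fun m p)
  (GRing.isZmodMorphism.Build _ _ (@cone_dS_fun m p) (@cone_dS_zmod m p))) _).
move=> p q h [x y]; congr (_, _); first exact: (nt_nat (splice m.+1)).
transitivity (fmap _ h (phi m.+1 p x - d m p y)); last by [].
by rewrite raddfB -!nt_nat.
Defined.

Definition cone_d n : nat_trans (cone n) (cone n.+1) :=
  if n is m.+1 then cone_dS m else cone_d0.

Lemma cone_exact n : exact_at (cone_d n) (cone_d n.+1).
Proof.
case: n => [|m] p [x y].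
  split=> [[dx /eqP]|[x' [<- <-]]]; last first.
    by congr (_, _); [exact: splice_splice | rewrite /= phi_splice subrr].
  have [x' <-] := splice_exact dx; rewrite phi_splice -raddfB => /eqP/ir_exact0[z zE].
  (* In the lowest degree the error is in the image of the augmentation, so it is absorbed by an
     element of [F 0], which [splice] kills. *)
  exists (x' - u 0%N p z); congr (_, _).
    by rewrite raddfB -[RHS]subr0; congr (_ - _); apply/splice_eq0; exists z.
  by rewrite raddfB phi_u psi0E zE opprB addrC subrK.
split=> [[dx /eqP]|[[x' y'] [<- <-]]]; last first.
  congr (_, _); first exact: splice_splice.
  by rewrite /= phi_splice raddfB dd subr0 subrr.
have [x' <-] := splice_exact dx; rewrite phi_splice -raddfB => /eqP/ir_exactS[w wE].
by exists (x', w); congr (_, _); rewrite /= wE opprB addrC subrK.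
Qed.

Lemma cone_flabby n : flabby (cone n).
Proof.
case: n => [|n]; first exact: up_product_flabby.
apply: pair_flabby; first exact: up_product_flabby.
exact/injective_flabby/ir_injective.
Qed.

(** The first differential is injective because [psi 0] is the augmentation, so its kernel has only
    the zero section; exactness and flabbiness propagate the property. *)
Lemma cone_flabby_ker n : flabby_ker (cone_d n).
Proof.
elim: n => [|n IHn]; last first.
  exact: (flabby_ker_next hdeg (@cone_flabby n) IHn (@cone_exact n)).
have inj0 p (x : cone 0 p) : cone_d 0 p x = 0 -> x = 0.
  move=> [/splice_eq0[z <-]]; rewrite phi_u psi0E => z0.
  rewrite (_ : z = 0) ?raddf0 //; apply: (@ir_aug_inj _ _ _ I p).
  by rewrite z0 raddf0.
move=> p s ss s0; exists 0; first exact: raddf0.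
by move=> q h pq; rewrite raddf0 (inj0 _ _ (s0 q pq)).
Qed.

Lemma cone_lim_exact n (c : dprod (cone n.+1)) : section_on setT c ->
  (forall p, cone_d n.+1 p (c p) = 0) ->
  exists2 b, section_on setT b & forall p, cone_d n p (b p) = c p.
Proof.
move=> cs c0; have [||b bs bE] := section_lift hdeg (@cone_flabby_ker n)
  (@cone_exact n) (U := setT) _ cs _ => //.
by exists b => // p; exact: bE.
Qed.

Let lim_mapE (A B : pfunctor P) (t : nat_trans A B) x p :
  val (lim_map t x) p = t p (val x p).
Proof. by []. Qed.

Lemma lim_u_pr n (x : limF (G n)) : lim_map (splice n) x = 0 ->
  exists z, lim_map (u n) z = x.
Proof.
have uD : exact_at (u n) (splice n) by move=> p y; exact: splice_eq0.
exact: (@lim_map_exact _ _ _ _ _ (u n) (splice n) (@uI n) uD x).1.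
Qed.

Lemma lim_psi_surj0 (y : limF (ir_obj I 0%N)) : lim_map (d 0%N) y = 0 ->
  exists z, lim_map (psi 0%N) z = y.
Proof.
have psiI p : injective (psi 0%N p).
  by move=> a b; rewrite !psi0E; exact: ir_aug_inj.
have psid : exact_at (psi 0%N) (d 0%N).
  by move=> p a; rewrite ir_exact0; split=> -[z zE]; exists z; rewrite -zE psi0E.
exact: (lim_map_exact psiI psid y).1.
Qed.

Lemma lim_psi_surjS m (y : limF (ir_obj I m.+1)) : lim_map (d m.+1) y = 0 ->
  exists z w, y = lim_map (psi m.+1) z - lim_map (d m) w.
Proof.
(* [y] becomes a cocycle of the cone. The first component of a primitive is killed by [splice], so
   it comes from the limit of [F m.+1]; the second is [w]. *)
move=> y0; pose c : dprod (cone m.+2) := fun p => (0, val y p).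
have [||b bs bE] := @cone_lim_exact m.+1 c.
- by move=> p q h _; congr (_, _); exact: lim_section.
- move=> p; congr (_, _); first exact: raddf0.
  by rewrite /= raddf0 sub0r -lim_mapE y0 oppr0.
have xs : @section_on _ _ (G m.+1) setT (fun p => (b p).1).
  by move=> p q h _; rewrite -(bs p q h Logic.I).
have ws : @section_on _ _ (ir_obj I m) setT (fun p => (b p).2).
  by move=> p q h _; rewrite -(bs p q h Logic.I).
have [|z zE] := lim_u_pr (x := lim_of_section xs).
  by apply: lim_ext => p; exact: (congr1 fst (bE p)).
exists z, (lim_of_section ws); apply: lim_ext => p.
have := congr1 snd (bE p); rewrite /= => <-; congr (_ - _).
by rewrite -phi_u -[u _ _ _]lim_mapE zE.
Qed.

Lemma lim_psi_kerS m (z : limF (F m.+1)) (w : limF (ir_obj I m)) :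
  lim_map (psi m.+1) z = lim_map (d m) w -> exists x, lim_map (pr m) x = z.
Proof.
(* The relation between [z] and [w] says that this pair is a cocycle; the component of a primitive
   in the product functor projects to [z]. *)
move=> zw; pose c : dprod (cone m.+1) := fun p => (u m.+1 p (val z p), val w p).
have [||b bs bE] := @cone_lim_exact m c.
- by move=> p q h _; congr (_, _); [rewrite -nt_nat lim_section | exact: lim_section].
- move=> p; congr (_, _); first by apply/splice_eq0; eexists.
  by rewrite /= phi_u -lim_mapE zw lim_mapE subrr.
have [xs xE] : exists2 x : dprod (G m), section_on setT x &
    forall p, splice m p (x p) = u m.+1 p (val z p).
  case: m z w zw @c b bs bE => [|m] z w zw c b bs bE.
    by exists b => // p; exact: (congr1 fst (bE p)).
  exists (fun p => (b p).1) => [p q h _|p]; first by rewrite -(bs p q h Logic.I).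
  exact: (congr1 fst (bE p)).
move=> xz; exists (lim_of_section xE); apply: lim_ext => p; apply: (@uI m.+1).
exact: xz.
Qed.

Lemma lim_psi_pr m (x : limF (G m)) :
  lim_map (psi m.+1) (lim_map (pr m) x) = lim_map (d m) (lim_map (phi m) x).
Proof. by apply: lim_ext => p; exact: psi_pr. Qed.

End Cone.

(** * The rank of the higher limits *)

Lemma qrank_bij (A B : zmodType) (f : {additive A -> B}) r :
  injective f -> (forall y, exists x, f x = y) -> qrank A r -> qrank B r.
Proof.
move=> fI fS [v [vi vs]]; exists (f \o v); split; first exact: indep_inj.
move=> y; have [x <-] := fS y; have [k k0 [c cE]] := vs x.
exists k => //; exists c; rewrite -raddfMz cE raddf_sum.
by apply: eq_bigr => j _; rewrite raddfMz.
Qed.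

Section HigherLimitRank.
Variables (disp : Order.disp_t) (P : porderType disp) (deg : P -> nat).
Hypothesis hdeg : graded deg.
Notation F := (Fn deg).
Notation G n := (up_product deg n (F n)).
Hypothesis uI : forall n p, injective (unit_hom deg n (F n) p).
Variable I : injective_resolution (const_functor P int).
Notation d := (ir_d I).
Notation u n := (unit_nt deg n (F n)).
Notation pr n := (proj_nt deg n (F n)).

Section ToHigherLimit.
Variable psi : forall n, nat_trans (F n) (ir_obj I n).
Hypothesis d_psi : forall n p x, d n p (psi n p x) = 0.

Lemma to_cocycle_subproof n (z : limF (F n)) :
  lim_map (psi n) z \in kerp (lim_map (d n)).
Proof. by apply/eqP; apply: lim_ext => p; exact: d_psi. Qed.

Definition to_cocycle_fun n (z : limF (F n)) : kernel (lim_map (d n)) :=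
  exist (fun y => y \in kerp (lim_map (d n))) _ (to_cocycle_subproof z).

Lemma to_cocycle_zmod n : zmod_morphism (@to_cocycle_fun n).
Proof. by move=> x y; apply: val_inj; exact: (raddfB (lim_map (psi n))). Qed.

Definition to_cocycle n : {additive limF (F n) -> kernel (lim_map (d n))} :=
  HB.pack (@to_cocycle_fun n)
    (GRing.isZmodMorphism.Build _ _ (@to_cocycle_fun n) (@to_cocycle_zmod n)).

Definition to_higher_lim_fun m (z : limF (F m.+1)) : higher_lim I m.+1 :=
  (\pi_(cohom (lim_map (d m)) (lim_map (d m.+1))) (to_cocycle m.+1 z))%qT.

Lemma to_higher_lim_zmod m : zmod_morphism (@to_higher_lim_fun m).
Proof.
move=> x y; rewrite /to_higher_lim_fun raddfB.
exact: (raddfB (\pi_(cohom (lim_map (d m)) (lim_map (d m.+1))))%qT).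
Qed.

Definition to_higher_lim m : {additive limF (F m.+1) -> higher_lim I m.+1} :=
  HB.pack (@to_higher_lim_fun m)
    (GRing.isZmodMorphism.Build _ _ (@to_higher_lim_fun m) (@to_higher_lim_zmod m)).

(** The case [x = 0] describes the kernel of the map; general [x] serves for its surjectivity. *)
Lemma to_higher_lim_eq m (x : kernel (lim_map (d m.+1))) (z : limF (F m.+1)) :
  to_higher_lim m z = (\pi_(cohom (lim_map (d m)) (lim_map (d m.+1))) x)%qT <->
  exists w, lim_map (d m) w = lim_map (psi m.+1) z - val x.
Proof.
rewrite /= /to_higher_lim_fun; split=> [/eqP|[w wE]].
  by rewrite -Quotient.idealrBE => /asboolP.
by apply/eqP; rewrite -Quotient.idealrBE; apply/asboolP; exists w.
Qed.

End ToHigherLimit.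

Lemma higher_lim_rank0 l : qrank (limF (F 0%N)) l -> qrank (higher_lim I 0) l.
Proof.
have [psi [phi [psi0E d_psi phi_u psi_pr]]] := comparison uI I.
apply: (qrank_bij (f := to_cocycle d_psi 0)) => [x y xy|y].
  apply: (lim_map_inj (t := psi 0%N)) => [p a b|].
    by rewrite !psi0E; exact: ir_aug_inj.
  exact: (congr1 (fun z : kernel (lim_map (d 0%N)) => val z) xy).
have [z zE] := lim_psi_surj0 psi0E (eqP (valP y)).
by exists z; exact: val_inj.
Qed.

(** Exactness of 0 -> lim F_m -> lim G_m -> lim F_(m+1) -> H^(m+1) -> 0, cut into two short exact
    sequences at the kernel of the last map. *)
Lemma higher_lim_rankS m g l :
  qrank (limF (G m)) g -> qrank (limF (F m.+1)) l ->
  exists a h, [/\ qrank (limF (F m)) a, qrank (higher_lim I m.+1) h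
    & (h + g = l + a)%N].
Proof.
have [psi [phi [psi0E d_psi phi_u psi_pr]]] := comparison uI I.
move=> Gg Fl; pose k := to_higher_lim d_psi m.
have kE z : k z = 0 <-> exists w, lim_map (d m) w = lim_map (psi m.+1) z.
  have := to_higher_lim_eq d_psi 0 z; rewrite -/k raddf0 => ->.
  by split=> -[w wE]; exists w; move: wE; rewrite subr0.
have kS y : exists z, k z = y.
  rewrite -(reprK y); set x := repr _; clearbody x.
  have [z [w xE]] := lim_psi_surjS hdeg uI psi0E phi_u psi_pr (eqP (valP x)).
  exists z; apply/to_higher_lim_eq; exists w.
  by rewrite xE opprB addrC subrK.
have prk x : lim_map (pr m) x \in kerp k.
  by apply/eqP/kE; exists (lim_map (phi m) x); rewrite -(lim_psi_pr psi_pr).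
pose q_fun x : kernel k := exist (fun z => z \in kerp k) _ (prk x).
have q_zmod : zmod_morphism q_fun.
  by move=> x y; apply: val_inj; exact: (raddfB (lim_map (pr m))).
pose q : {additive limF (G m) -> kernel k} :=
  HB.pack q_fun (GRing.isZmodMorphism.Build _ _ q_fun q_zmod).
have qS y : exists x, q x = y.
  have /kE[w wE] : k (val y) = 0 by exact/eqP/(valP y).
  have [x xE] := lim_psi_kerS hdeg uI psi0E phi_u psi_pr (esym wE).
  by exists x; exact: val_inj.
have u_pr : exact_at (u m) (pr m) by move=> p y; exact: coker_pi_eq0.
have qE x : q x = 0 <-> exists z, lim_map (u m) z = x.
  rewrite -(@lim_map_exact _ _ _ _ _ (u m) (pr m) (@uI m) u_pr x).
  by split=> [/(congr1 val)//|x0]; exact: val_inj.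
have [a [r [Fa kr <-]]] := qrank_exact (lim_map_inj (t := u m) (@uI m)) qS qE Gg.
have valE z : k z = 0 <-> exists y : kernel k, val y = z.
  split=> [/eqP zk|[y <-]]; last exact/eqP/(valP y).
  by exists (exist (fun z => z \in kerp k) z zk).
have [r' [h [kr' Hh <-]]] := qrank_exact (i := val : {additive kernel k -> _})
  val_inj kS valE Fl.
exists a, h; split=> //.
by rewrite (qrank_unique kr kr') addnCA addnC (addnC h).
Qed.

End HigherLimitRank.

Section LimUpProduct.
Variables (disp : Order.disp_t) (P : porderType disp) (deg : P -> nat).
Variables (n : nat) (A : pfunctor P).

Definition lim_eval_fun p (x : limF (up_product deg n A)) : A p :=
  prod_eval A (up deg p n) p (val x p).

Lemma lim_eval_zmod p : zmod_morphism (@lim_eval_fun p).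
Proof. by move=> x y; exact: (raddfB (prod_eval A (up deg p n) p)). Qed.

Definition lim_eval p : {additive limF (up_product deg n A) -> A p} :=
  HB.pack (@lim_eval_fun p)
    (GRing.isZmodMorphism.Build _ _ (@lim_eval_fun p) (@lim_eval_zmod p)).

(** In a compatible family the coordinate at [q] is the same for all [p] below [q], so it is
    determined by the component at [q] itself: the limit is the product of [A] over [Ob deg n]. *)
Lemma qrank_lim_up_product (rk : P -> int) :
  (forall p, Ob deg n p -> exists2 r, qrank (A p) r & r%:Z = rk p) ->
  (forall p, Ob deg n p -> torsionfree (A p)) ->
  finite_set [set p | Ob deg n p /\ rk p <> 0] ->
  exists2 r, qrank (limF (up_product deg n A)) r & r%:Z = \sum_(p \in Ob deg n) rk p.
Proof.
move=> Ar At fA; apply: (qrank_joint Ar At fA (ev := lim_eval)) => [x x0|y].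
  apply: lim_ext => p; apply: prodF_ext => q uq; have [pq dq] := uq.
  rewrite raddf0 -(x0 q dq) /= /lim_eval_fun -(lim_section x pq Logic.I).
  by rewrite prod_eval_proj.
have ys : @section_on _ _ (up_product deg n A) setT (fun p => prod_restr _ y).
  move=> p q h _; apply: prodF_ext => r ur.
  by rewrite prod_eval_proj // !prod_eval_restr //; exact: up_sub ur.
exists (lim_of_section ys) => p dp; apply: prod_eval_restr.
by split.
Qed.

End LimUpProduct.

(** * The inequalities between Betti numbers *)

Lemma alternating_sum_recr (x : nat -> int) n :
  \sum_(0 <= i < n.+2) (-1) ^+ (n.+1 - i) * x i
  = x n.+1 - \sum_(0 <= i < n.+1) (-1) ^+ (n - i) * x i.
Proof.
rewrite big_nat_recr //= subnn mul1r addrC -sumrN; congr (_ + _).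
rewrite !big_nat; apply: eq_bigr => i; rewrite ltnS => /andP[_ ilen].
by rewrite subSn // exprS mulN1r mulNr.
Qed.

Theorem proposition5p4 (disp : Order.disp_t) (P : porderType disp)
    (deg : P -> nat) (hdeg : graded deg)
    (J : P -> nat -> set P) (hJ : local_covering_family deg J)
    (hJa : adequate deg J)
    (K : nat -> set P) (hK : global_covering_family deg K)
    (I : injective_resolution (const_functor P int))
    (n : nat) (hfin : covering_betti_defined deg K n) :
  exists b : nat -> nat,
    [/\ forall i : nat, (i <= n)%N -> has_rank (higher_lim I i) (b i),
        (b n)%:Z <= covering_betti deg K n
      & \sum_(0 <= i < n.+1) (-1) ^+ (n - i) * (b i)%:Z
          <= \sum_(0 <= i < n.+1) (-1) ^+ (n - i) * covering_betti deg K i].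
Proof.
have uI := unit_inj hdeg hJ hJa.
have Fr i p : Ob deg i p ->
    torsionfree (Fn deg i p) /\ exists2 r, qrank (Fn deg i p) r & r%:Z = Rnum deg i p.
  by move=> dp; apply: (local_structure hdeg hJ hJa i).2; rewrite dp.
have KOb := gcf_sub hK; have [finO finK] := hfin.
(* Below [n] finiteness passes from [Ob deg i] to its subset [K i]; at [n] it is assumed. *)
have finKi i : (i <= n)%N -> finite_set [set p | K i p /\ Rnum deg i p <> 0].
  rewrite leq_eqVlt => /predU1P[->//|/finO]; apply: sub_finite_set => p [/KOb dp].
  by split.
pose k i : int := \sum_(p \in K i) Rnum deg i p.
pose c i : int := \sum_(p \in Ob deg i) Rnum deg i p.
have limF_rank i : (i <= n)%N -> exists2 l, qrank (limF (Fn deg i)) l & l%:Z <= k i.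
  move=> /finKi fi; have [r Kr rE] : exists2 r, qrank (prodF (Fn deg i) (K i)) r &
      r%:Z = k i.
    by apply: qrank_prodF fi => p /KOb/Fr[].
  have res_zmod : zmod_morphism (@lim_restr _ _ (Fn deg i) (K i)) by [].
  pose res : {additive limF (Fn deg i) -> prodF (Fn deg i) (K i)} :=
    HB.pack (@lim_restr _ _ (Fn deg i) (K i))
      (GRing.isZmodMorphism.Build _ _ (@lim_restr _ _ (Fn deg i) (K i)) res_zmod).
  have [l lr Fl] := qrank_sub (i := res) (@gcf_inj _ _ _ _ hK i) Kr.
  by exists l; rewrite // -rE lez_nat.
have /choice[l lE] i : exists l, (i <= n)%N -> qrank (limF (Fn deg i)) l /\ l%:Z <= k i.
  have [/limF_rank[l Fl lk]|_] := leqP i n; first by exists l.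
  by exists 0%N.
have bS i : (i < n)%N -> exists b, has_rank (higher_lim I i.+1) b /\
    b%:Z = (l i)%:Z - c i + (l i.+1)%:Z.
  move=> ltin; have [g Gg gE] := qrank_lim_up_product
    (fun p dp => (Fr i p dp).2) (fun p dp => (Fr i p dp).1) (finO i ltin).
  have [a [h [Fa Hh hE]]] := higher_lim_rankS hdeg uI I Gg (lE i.+1 ltin).1.
  exists h; split; first exact: has_rank_qrank.
  rewrite -(qrank_unique Fa (lE i (ltnW ltin)).1) /c -gE -addrA addrCA -PoszD addnC -hE.
  by rewrite PoszD addrC addrK.
(* Index 0 is separate, as no functor precedes [F 0]; beyond [n] the value 0 is a filler. *)
have /choice[b bE] i : exists b, (i <= n)%N -> has_rank (higher_lim I i) b /\
    b%:Z = (if i is m.+1 then (l m)%:Z - c m else 0) + (l i)%:Z.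
  case: i => [|i]; last by have [/bS[b]|] := ltnP i n; [exists b | exists 0%N].
  exists (l 0%N) => _; rewrite add0r; split=> //.
  exact/has_rank_qrank/higher_lim_rank0/(lE 0%N isT).1.
have bettiE i : covering_betti deg K i = (if i is m.+1 then k m - c m else 0) + k i.
  by case: i => [|i] //=; rewrite add0r.
exists b; split=> [i /bE[]//||].
  rewrite (bE n (leqnn n)).2 bettiE lerD ?(lE n _).2 //.
  case: n lE {hfin finO finK finKi limF_rank bS bE} => [//|m] lE.
  by rewrite lerD2r (lE m _).2.
(* The difference telescopes: in the step to [m.+1] the terms [c m] cancel, and the new contribution
   [k m - l m] cancels the previous difference. *)
suff alt m : (m <= n)%N ->
    \sum_(0 <= i < m.+1) (-1) ^+ (m - i) * covering_betti deg K i
    - \sum_(0 <= i < m.+1) (-1) ^+ (m - i) * (b i)%:Z = k m - (l m)%:Z.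
  by rewrite -subr_ge0 alt // subr_ge0 (lE n _).2.
elim: m => [|m IHm] mn.
  by rewrite !big_nat1 !mul1r bettiE (bE 0%N _).2 // !add0r.
rewrite !alternating_sum_recr bettiE (bE m.+1 _).2 //.
have := IHm (ltnW mn); set s := \sum_(_ <= _ < _) _; set t := \sum_(_ <= _ < _) _.
move=> /eqP; rewrite subr_eq => /eqP->.
by ring.
Qed.
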